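(* Let $q\ge 1$ be a fixed integer and let $\alpha_1,\alpha_2,\ldots,\alpha_q$ be positive constants such that $\alpha_1+\alpha_2+\cdots+\alpha_q=1$. Let $\alpha_{\min}=\min\{\alpha_i : i\in[q]\}$. Let $\omega=\omega(n)$ be any function with $\omega(n)\to\infty$ as $n\to\infty$, and let $p=p(n)=\frac{\log n+\omega}{\alpha_{\min}\, n}$, where $p\in[0,1]$. Let $G$ be the random bipartite graph $G_{n,n,p}$, and suppose that the edges of $G$ are independently colored with colors from $C=\{c_1,c_2,\ldots,c_q\}$, where $\mathbb{P}(c(e)=c_i)=\alpha_i$ for each $e\in E(G)$ and $i\in[q]$. Then, with high probability, the following holds simultaneously for all non-negative integers $m_1,m_2,\ldots,m_q$ satisfying $m_1+\cdots+m_q=n$: there exists a perfect matching $M$ of $G$ in which exactly $m_i$ edges are colored with $c_i$, for $i=1,2,\ldots,q$. In other words, with high probability, $$\mathrm{mcp}(G)=\{(m_1,\ldots,m_q)\in\{0,1,\ldots,n\}^q : m_1+\cdots+m_q=n\}.$$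
   Context: $[q]=\{1,\ldots,q\}$, and $\log$ is the natural logarithm. $G_{n,n,p}$ is the random bipartite graph with vertex classes $A$ and $B$, $|A|=|B|=n$, in which each of the $n^2$ possible edges between $A$ and $B$ is present independently with probability $p$. Given $G$, each edge $e$ receives a random color $c(e)$, independently over edges. For $i\in[q]$, $Q_i=\{e\in E(G): c(e)=c_i\}$ is the $i$-th color class. The perfect matching color profile $\mathrm{mcp}(G)$ of the edge-colored graph $G$ is the set of vectors $(m_1,\ldots,m_q)$ such that there exists a perfect matching $M$ in $G$ with $|Q_i\cap M|=m_i$ for all $i\in[q]$. A sequence of events $E_n$ occurs with high probability if $\mathbb{P}(E_n)\to 1$ as $n\to\infty$; the probability is over both the random graph and the random coloring. *)

(* Defs.v *)
From HB Require Import structures.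
From mathcomp Require Import all_boot all_order all_algebra.
From mathcomp Require Import all_classical all_reals all_analysis.

Set Implicit Arguments.
Unset Strict Implicit.
Unset Printing Implicit Defensive.

Import Order.TTheory GRing.Theory Num.Theory.
Import numFieldNormedType.Exports.

Local Open Scope classical_set_scope.
Local Open Scope ring_scope.

(* The vertex classes A and B are two copies of 'I_n; the pair (a, b) is the
   potential edge joining a in A to b in B. *)
Definition edge (n : nat) : finType := ('I_n * 'I_n)%type.

Definition bigraph (n : nat) : finType := {set edge n}.

(* Colors are attached to all potential edges, but only those of the edges of
   the graph are ever used (see [color_class]). *)
Definition coloring (q n : nat) : finType := {ffun edge n -> 'I_q}.

Definition color_class (q n : nat) (G : bigraph n) (c : coloring q n)
    (i : 'I_q) : {set edge n} :=
  [set e in G | c e == i].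

Definition perfect_matching (n : nat) (G : bigraph n) (M : {set edge n}) : Prop :=
  [/\ M \subset G,
      forall a : 'I_n, #|[set e in M | e.1 == a]| = 1%N
    & forall b : 'I_n, #|[set e in M | e.2 == b]| = 1%N].

(* Matching color profile. *)
Definition mcp (q n : nat) (G : bigraph n) (c : coloring q n) :
    set ('I_q -> nat) :=
  [set m | exists M : {set edge n}, perfect_matching G M /\
             forall i : 'I_q, #|color_class G c i :&: M| = m i].

Definition all_profiles (q n : nat) : set ('I_q -> nat) :=
  [set m | (forall i : 'I_q, (m i <= n)%N) /\ (\sum_(i < q) m i)%N = n].

Arguments all_profiles : clear implicits.

Section Probability.
Variable R : realType.

Definition graph_weight (n : nat) (p : R) (G : bigraph n) : R :=
  \prod_(e : edge n) (if e \in G then p else 1 - p).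

Definition coloring_weight (q n : nat) (alpha : 'I_q -> R) (c : coloring q n) : R :=
  \prod_(e : edge n) alpha (c e).

(* The colors of the edges of G, given G, are independent with law alpha:
   summing the colors of the non-edges out of the product weight below leaves
   graph_weight p G * \prod_(e in G) alpha (c e) when alpha sums to 1. *)
Definition Pr (q n : nat) (p : R) (alpha : 'I_q -> R)
    (E : set (bigraph n * coloring q n)) : R :=
  \sum_(w : bigraph n * coloring q n | w \in E)
     graph_weight p w.1 * coloring_weight alpha w.2.

(* The default value 1 does not affect the minimum: the theorem's alpha is
   bounded by 1, being positive with sum 1. *)
Definition alpha_min (q : nat) (alpha : 'I_q -> R) : R :=
  \big[Num.min/1]_(i < q) alpha i.

End Probability.

(* Main.v *)
(* The edges of color k form a random bipartite graph with edge probability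
   p alpha_k, and lam = n p alpha_k is at least log n + omega.  Fix a set R of
   about n / (4q) vertices on each side, and call a vertex poor in color k if
   it sends fewer than a small multiple of lam edges of color k to R.
   With high probability few vertices outside R are adjacent in color k to a
   poor vertex.  Given a profile m, let k be a color with m_k >= n / q.
   Greedily choose m_i edges of each color i <> k, avoiding R and the neighbors
   of the poor vertices; this is possible since any two large sets are joined
   by an edge of every color.  It remains to match the m_k unused vertices on
   each side in color k.  There a poor vertex keeps all of its neighbors and
   any other vertex keeps its many neighbors in R, so that a minimal violator X
   of Hall's condition, with neighborhood Y, #|Y| = #|X| - 1, is either mostly
   rich, and then X and Y span too many edges, or mostly poor, and then Y
   contains all the neighbors of three quarters of X.  Both are ruled out by a
   first-moment computation; the case #|X| = 1 of the second, an isolated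
   vertex, is where log n + omega is needed.
   Instead of probabilities of events, the proof bounds the expectations of
   nonnegative penalties whose sum is at least 1 whenever the conclusion fails. *)

Require Import Defs.
From HB Require Import structures.
From mathcomp Require Import all_boot all_order all_algebra.
From mathcomp Require Import all_classical all_reals all_analysis.
From mathcomp Require Import zify ring lra.

Set Implicit Arguments.
Unset Strict Implicit.
Unset Printing Implicit Defensive.

Import Order.TTheory GRing.Theory Num.Theory.
Import numFieldNormedType.Exports.
(* classical_sets shadows the names of finset. *)
Import mathcomp.boot.fintype mathcomp.boot.finset.

(** * Hall's marriage theorem *)

Section Bipartite.
Variables (S T : finType).
Implicit Types (E M : {set S * T}) (X Z : {set S}) (Y : {set T}).

Definition nbhd E X : {set T} := [set y | [exists x in X, (x, y) \in E]].

Definition matching M := {in M &, injective fst} /\ {in M &, injective snd}.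

Lemma nbhdP E X y :
  reflect (exists2 x, x \in X & (x, y) \in E) (y \in nbhd E X).
Proof.
rewrite inE; apply: (iffP existsP) => [[x /andP[xX xy]]|[x xX xy]]; exists x => //.
by rewrite xX.
Qed.

Lemma nbhdU E X Z : nbhd E (X :|: Z) = nbhd E X :|: nbhd E Z.
Proof.
apply/setP => y; rewrite in_setU; apply/nbhdP/orP.
  move=> [x]; rewrite inE => /orP[xX|xZ] xy; [left|right]; apply/nbhdP; by exists x.
by move=> [] /nbhdP[x xX xy]; exists x => //; rewrite inE xX ?orbT.
Qed.

Lemma nbhdS E X Z : X \subset Z -> nbhd E X \subset nbhd E Z.
Proof. by move=> /setUidPr <-; rewrite nbhdU subsetUl. Qed.

Lemma matching0 : matching set0.
Proof. by split => x y; rewrite inE. Qed.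

Lemma matching1 e : matching [set e].
Proof. by split => x y; rewrite !inE => /eqP -> /eqP ->. Qed.

Lemma matchingU M1 M2 : matching M1 -> matching M2 ->
    [disjoint fst @: M1 & fst @: M2] -> [disjoint snd @: M1 & snd @: M2] ->
  matching (M1 :|: M2).
Proof.
move=> [f1 s1] [f2 s2] /pred0P df /pred0P ds.
have F x y : x \in M1 -> y \in M2 -> x.1 <> y.1.
  move=> x1 y2 xy; have /negP := df x.1; apply; rewrite /= imset_f//=.
  by rewrite xy imset_f.
have G x y : x \in M1 -> y \in M2 -> x.2 <> y.2.
  move=> x1 y2 xy; have /negP := ds x.2; apply; rewrite /= imset_f//=.
  by rewrite xy imset_f.
split=> x y; rewrite !inE => /orP[x1|x2] /orP[y1|y2] xy.
- exact: f1.
- by case: (F x y).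
- by case: (F y x).
- exact: f2.
- exact: s1.
- by case: (G x y).
- by case: (G y x).
- exact: s2.
Qed.

(* Halmos and Vaughan: either some proper nonempty Z is tight, and Z and X :\: Z
   are matched separately, or an arbitrary edge can be used. *)
Theorem hall_marriage E X Y :
  (forall Z, Z \subset X -> (#|Z| <= #|nbhd E Z :&: Y|)%N) ->
  exists M, [/\ matching M, M \subset E, fst @: M = X & snd @: M \subset Y].
Proof.
have [m] := ubnP #|X|; elim: m => // m IHm in X Y *; rewrite ltnS => Xm hallX.
have [->|[x0 x0X]] := set_0Vmem X.
  by exists set0; split; rewrite ?imset0 ?sub0set //; exact: matching0.
have [/existsP[Z /and4P[ZX Z0 ZnX Ztight]]|] := boolP [exists Z : {set S},
  [&& Z \subset X, Z != set0, Z != X & #|nbhd E Z :&: Y| == #|Z|]].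
  have ZltX : (#|Z| < #|X|)%N by rewrite proper_card // properEneq ZnX.
  have [||M1 [M1m M1E M1f M1s]] := IHm Z (nbhd E Z :&: Y).
  - exact: leq_trans ZltX Xm.
  - move=> W WZ; rewrite setIA (setIidPl (nbhdS _ WZ)).
    by apply: hallX; exact: subset_trans ZX.
  have [||M2 [M2m M2E M2f M2s]] := IHm (X :\: Z) (Y :\: nbhd E Z).
  - rewrite cardsD (setIidPr ZX); apply: leq_trans Xm.
    by rewrite ltn_subrL !card_gt0 Z0; apply/set0Pn; exists x0.
  - move=> W; rewrite subsetD => /andP[WX WZ].
    (* Hall's condition for [W :|: Z], minus the equality for the tight set [Z], is Hall's condition
       for [W] outside the neighborhood of [Z]. *)
    have := hallX (W :|: Z); rewrite subUset WX ZX => /(_ isT).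
    rewrite cardsU (disjoint_setI0 WZ) cards0 subn0 nbhdU.
    have -> : (nbhd E W :|: nbhd E Z) :&: Y =
        (nbhd E W :&: (Y :\: nbhd E Z)) :|: (nbhd E Z :&: Y).
      apply/setP => y; rewrite !(in_setI, in_setU, in_setD).
      by case: (y \in nbhd E W); case: (y \in nbhd E Z); case: (y \in Y).
    rewrite cardsU (eqP Ztight).
    have -> : nbhd E W :&: (Y :\: nbhd E Z) :&: (nbhd E Z :&: Y) = set0.
      apply/setP => y; rewrite !(in_setI, in_setD) in_set0.
      by case: (y \in nbhd E W); case: (y \in nbhd E Z); case: (y \in Y).
    by rewrite cards0 subn0 leq_add2r.
  exists (M1 :|: M2); split.
  - apply: matchingU => //.
      by rewrite M1f M2f disjoint_sym disjoints_subset subsetDr.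
    rewrite disjoint_sym; apply: disjointWl M2s _.
    rewrite disjoint_sym; apply: disjointWl M1s _.
    rewrite disjoints_subset; apply/subsetP => y; rewrite !(in_setI, in_setC, in_setD).
    by case: (_ \in nbhd _ _) => //= /andP[].
  - by rewrite subUset M1E.
  - by rewrite imsetU M1f M2f -{1}(setIidPr ZX) setID.
  - rewrite imsetU subUset (subset_trans M1s (subsetIr _ _)).
    by rewrite (subset_trans M2s (subsetDl _ _)).
(* No proper nonempty subset is tight, so the strict inequality absorbs the loss of the single
   vertex [y0]. *)
rewrite negb_exists => /forallP noT.
have /set0Pn[y0 /setIP[/nbhdP[_ /set1P -> x0y0] y0Y]] :
    nbhd E [set x0] :&: Y != set0.
  by rewrite -card_gt0 -(cards1 x0) hallX // sub1set.
have [||M [Mm ME Mf Ms]] := IHm (X :\ x0) (Y :\ y0).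
- by apply: leq_trans Xm; rewrite [X in (_ < X)%N](cardsD1 x0) x0X.
- move=> W; rewrite subsetD1 => /andP[WX x0W].
  have [->|W0] := eqVneq W set0; first by rewrite cards0.
  have WneX : W != X by apply: contraNneq x0W => ->.
  have := noT W; rewrite WX W0 WneX /= => Wloose.
  have : (#|W| < #|nbhd E W :&: Y|)%N by rewrite ltn_neqAle eq_sym Wloose hallX.
  rewrite (cardsD1 y0) setIDA => h.
  have := leq_b1 (y0 \in nbhd E W :&: Y); lia.
exists ((x0, y0) |: M); split.
- apply: matchingU => //; first exact: matching1.
    by rewrite imset_set1 disjoints1 Mf !inE eqxx.
  rewrite imset_set1 disjoints1; apply/negP => /(subsetP Ms).
  by rewrite !inE eqxx.
- by rewrite subUset sub1set x0y0.
- by rewrite imsetU imset_set1 Mf setD1K.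
- rewrite imsetU imset_set1 subUset sub1set y0Y /=.
  exact: subset_trans Ms (subsetDl _ _).
Qed.
End Bipartite.

(** * Expansion in a bipartite graph *)

Section Counting.
Variables (S T : finType).
Implicit Types (E : {set S * T}) (X U Z : {set S}) (Y : {set T}).

Definition ecount E X Y := #|E :&: setX X Y|.

Definition transpose E : {set T * S} := swap_pair @^-1: E.

Lemma nbhd1E E x y : (y \in nbhd E [set x]) = ((x, y) \in E).
Proof. by apply/nbhdP/idP => [[_ /set1P ->]|xy] //; exists x => //; rewrite set11. Qed.

Lemma ecount1l E x Y : ecount E [set x] Y = #|nbhd E [set x] :&: Y|.
Proof.
rewrite -(card_imset _ (fun y y' (h : (x, y) = (x, y')) => congr1 snd h)).
apply: eq_card => -[a b]; apply/idP/imsetP => [|[y]].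
  rewrite !inE /= => /and3P[abE /eqP <- bY]; exists b => //.
  by rewrite in_setI nbhd1E abE.
by rewrite in_setI nbhd1E => /andP[xyE yY] [-> ->]; rewrite !inE xyE eqxx.
Qed.

Lemma ecount_suml E X Y : ecount E X Y = \sum_(x in X) ecount E [set x] Y.
Proof.
rewrite /ecount -sum1_card (partition_big fst [in X]) => [|e]; last first.
  by rewrite !inE => /and3P[].
apply: eq_bigr => x xX; rewrite -sum1_card; apply: eq_bigl => -[a b].
by rewrite !inE /=; case: (a =P x) => [->|_]; rewrite ?xX ?andbF ?andbT.
Qed.

End Counting.

Lemma ecount_transpose (S T : finType) (E : {set S * T}) X Y :
  ecount (transpose E) Y X = ecount E X Y.
Proof.
rewrite /ecount -(card_imset _ (can_inj (@swap_pairK S T))).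
apply: eq_card => -[b a]; apply/idP/imsetP => [|[[a' b'] + [-> ->]]].
  rewrite !inE /swap_pair /= => /and3P[abE bY aX]; exists (a, b) => //.
  by rewrite !inE abE aX bY.
by rewrite !inE /swap_pair /= => /and3P[-> -> ->].
Qed.

(** * Hall's condition for small sets of vertices *)

Section SmallSets.
Variables (S T : finType).
Implicit Types (E : {set S * T}) (X U Z : {set S}) (Y R : {set T}).

Definition poor E R d : {set S} := [set x | (ecount E [set x] R < d)%N].

(* The last clause excludes in particular, for #|X| = 1, isolated vertices. *)
Definition expands E R d e0 h :=
  [/\ (#|nbhd E (poor E R (4 * d)) :\: R| <= h)%N,
      forall X Y, (0 < #|X| < e0)%N -> #|Y|.+1 = #|X| ->
        (ecount E X Y < d * #|X|)%N
    & forall X Y U, (0 < #|X| < e0)%N -> #|Y|.+1 = #|X| -> U \subset X ->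
        (3 * #|X| <= 4 * #|U|)%N -> nbhd E U \subset Y ->
        (ecount E X Y < 2 * #|Y|)%N].

(* A minimal violator X has exactly #|X| - 1 neighbors, each of them joined
   to X by at least two edges. *)
Lemma expands_hall E R d e0 h Y0 : expands E R d e0 h ->
    R \subset Y0 -> nbhd E (poor E R (4 * d)) \subset Y0 ->
  forall X, (#|X| < e0)%N -> (#|X| <= #|nbhd E X :&: Y0|)%N.
Proof.
move=> [_ sparse tree] RY0 poorY0 X.
have [m] := ubnP #|X|; elim: m => // m IHm in X *; rewrite ltnS => Xm Xe0.
rewrite leqNgt; apply/negP; set Y := nbhd E X :&: Y0 => YX.
have X0 : (0 < #|X|)%N by exact: leq_trans YX.
(* By the induction hypothesis [X :\ x] is no violator, so deleting any one vertex of [X] loses no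
   neighbor. *)
have tight x : x \in X -> #|Y|.+1 = #|X| /\ nbhd E (X :\ x) :&: Y0 = Y.
  move=> xX; have cX := cardsD1 x X; rewrite xX in cX.
  have : (#|X :\ x| <= #|nbhd E (X :\ x) :&: Y0|)%N by apply: IHm; lia.
  have sub : nbhd E (X :\ x) :&: Y0 \subset Y by rewrite setSI // nbhdS // subsetDl.
  have := subset_leq_card sub => le1 le2; split; first lia.
  by apply/eqP; rewrite eqEcard sub; lia.
have [x0 x0X] : exists x, x \in X by apply/set0Pn; rewrite -card_gt0.
have [YS _] := tight _ x0X.
have low2 : (2 * #|Y| <= ecount E X Y)%N.
  rewrite -ecount_transpose ecount_suml mulnC -sum_nat_const.
  apply: leq_sum => y yY; rewrite ecount1l; apply/card_gt1P.
  (* As [y] remains a neighbor after the deletion of [x1], it has a second neighbor [x2] in [X]. *)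
  have /setIP[/nbhdP[x1 x1X x1y] _] := yY.
  have [_ /setP /(_ y)] := tight _ x1X; rewrite yY.
  move=> /setIP[/nbhdP[x2 /setD1P[x2x1 x2X] x2y] _].
  exists x1, x2; split; last by rewrite eq_sym.
    by rewrite in_setI nbhd1E !inE x1y.
  by rewrite in_setI nbhd1E !inE x2y.
have X0e : (0 < #|X| < e0)%N by rewrite X0.
(* If three quarters of [X] are poor, all their neighbors lie in [Y], and [low2] contradicts the
   third clause. Otherwise a quarter of [X] is rich, each such vertex sends at least [4 * d] edges
   to [R], hence to [Y], and these contradict the second clause. *)
have [few|many] := leqP (3 * #|X|) (4 * #|X :&: poor E R (4 * d)|).
  have := tree X Y (X :&: poor E R (4 * d)) X0e YS (subsetIl _ _) few.
  rewrite ltnNge low2 => H; suff /H : nbhd E (X :&: poor E R (4 * d)) \subset Y by [].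
  rewrite subsetI nbhdS ?subsetIl //=.
  by apply: subset_trans poorY0; rewrite nbhdS // subsetIr.
have := sparse X Y X0e YS; rewrite ltnNge => /negP; apply.
have rich : (#|X| <= 4 * #|X :\: poor E R (4 * d)|)%N.
  by rewrite cardsD; have := subset_leq_card (subsetIl X (poor E R (4 * d))); lia.
apply: (@leq_trans (\sum_(x in X :\: poor E R (4 * d)) 4 * d)%N).
  by rewrite sum_nat_const mulnA [X in (_ <= X)%N]mulnC leq_mul2l mulnC rich orbT.
rewrite ecount_suml [X in (_ <= X)%N](big_setID (poor E R (4 * d))) /= addnC.
apply: leq_trans; last exact: leq_addr.
apply: leq_sum => x /setDP[xX].
rewrite inE -leqNgt => /leq_trans; apply; rewrite !ecount1l.
apply: subset_leq_card; rewrite subsetI subsetIl /= subsetI.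
rewrite (subset_trans (subsetIr _ _) RY0) andbT.
apply: (subset_trans (subsetIl _ _)).
by rewrite nbhdS // sub1set.
Qed.
End SmallSets.

(** For a large [X], the set [B :\: nbhd E X] has no edge to [X], so density makes it small. Hall's
    condition from the other side bounds its size by that of its neighborhood in [A], which avoids
    [X]; since [#|A| = #|B|], taking complements gives the claim. *)
Lemma hall_two_sided (S T : finType) (E : {set S * T}) e0 (A : {set S}) (B : {set T}) :
    #|A| = #|B| ->
    (forall X : {set S}, (#|X| < e0)%N -> (#|X| <= #|nbhd E X :&: B|)%N) ->
    (forall Y : {set T}, (#|Y| < e0)%N -> (#|Y| <= #|nbhd (transpose E) Y :&: A|)%N) ->
    (forall (X : {set S}) (Y : {set T}), (e0 <= #|X|)%N -> (e0 <= #|Y|)%N ->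
      E :&: setX X Y != set0) ->
  forall X : {set S}, X \subset A -> (#|X| <= #|nbhd E X :&: B|)%N.
Proof.
move=> AB smallA smallB dense X XA.
have [|Xbig] := ltnP #|X| e0; first exact: smallA.
have noedge (Y : {set T}) : [disjoint Y & nbhd E X] -> E :&: setX X Y = set0.
  move=> dis; apply/setP => -[a b]; rewrite !inE /=.
  apply/negP => /and3P[ab aX bY]; have /pred0P /(_ b) := dis.
  by rewrite /= bY => /negP; apply; apply/nbhdP; exists a.
have disY : [disjoint B :\: nbhd E X & nbhd E X].
  by rewrite disjoints_subset subsetDr.
have small : (#|B :\: nbhd E X| < e0)%N.
  rewrite ltnNge; apply/negP => /(dense _ _ Xbig).
  by rewrite noedge // eqxx.
have := smallB _ small.
have : nbhd (transpose E) (B :\: nbhd E X) :&: A \subset A :\: X.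
  apply/subsetP => a /setIP[/nbhdP[b /setDP[bB bX]]]; rewrite inE => ba aA.
  rewrite inE aA andbT; apply: contra bX => aX.
  by apply/nbhdP; exists a.
move=> /subset_leq_card.
rewrite cardsD (setIidPr XA) [#|B :\: _|]cardsD [B :&: _]setIC -AB.
have := subset_leq_card XA.
have := subset_leq_card (subsetIr (nbhd E X) B); lia.
Qed.

(** * Color profiles from expansion *)

Section Profiles.
Variables (q n : nat).
Implicit Types (G M : {set edge n}) (c : coloring q n) (m : 'I_q -> nat).

Lemma card_color_classes G c M : M \subset G ->
  #|M| = \sum_(i < q) #|color_class G c i :&: M|.
Proof.
move=> MG; rewrite -sum1_card (partition_big c xpredT) //=.
apply: eq_bigr => i _; rewrite -sum1_card; apply: eq_bigl => e.
rewrite !inE; case eM: (e \in M); last by rewrite andbF.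
by rewrite (subsetP MG) // andbT.
Qed.

Lemma matching_card_fst M : matching M -> #|fst @: M| = #|M|.
Proof. by case=> inj _; exact: card_in_imset. Qed.

Lemma matching_card_snd M : matching M -> #|snd @: M| = #|M|.
Proof. by case=> _ inj; exact: card_in_imset. Qed.

Lemma perfect_matching_of_card G M :
  M \subset G -> matching M -> #|M| = n -> perfect_matching G M.
Proof.
move=> MG Mm Mn; split=> // a.
  have : a \in fst @: M.
    have /eqP -> : fst @: M == setT.
      by rewrite eqEcard subsetT cardsT card_ord matching_card_fst // Mn leqnn.
    by rewrite inE.
  move=> /imsetP[e eM ->]; apply/eqP/cards1P; exists e.
  apply/setP => e'; rewrite !inE; apply/andP/eqP => [[e'M /eqP h]|->//].
  by case: Mm => inj _; exact: inj.
have : a \in snd @: M.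
  have /eqP -> : snd @: M == setT.
    by rewrite eqEcard subsetT cardsT card_ord matching_card_snd // Mn leqnn.
  by rewrite inE.
move=> /imsetP[e eM ->]; apply/eqP/cards1P; exists e.
apply/setP => e'; rewrite !inE; apply/andP/eqP => [[e'M /eqP h]|->//].
by case: Mm => _ inj; exact: inj.
Qed.

Lemma card_perfect_matching G M : perfect_matching G M -> #|M| = n.
Proof.
move=> [_ deg1 _]; rewrite -sum1_card (partition_big fst xpredT) //=.
rewrite (eq_bigr (fun=> 1%N)) ?sum_nat_const ?card_ord ?muln1 // => a _.
by rewrite -[RHS](deg1 a) -sum1_card; apply: eq_bigl => e; rewrite !inE.
Qed.

Lemma mcp_sub_all_profiles G c m : mcp G c m -> all_profiles q n m.
Proof.
move=> [M [pM Mm]]; have Mn := card_perfect_matching pM; case: pM => MG _ _.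
have sm : \sum_(i < q) m i = n.
  by rewrite -[RHS]Mn (card_color_classes c MG); apply: eq_bigr => i _.
by split=> // i; rewrite -[X in (_ <= X)%N]sm (bigD1 i) //= leq_addr.
Qed.

Definition dense_classes G c e0 := forall i (X Y : {set 'I_n}),
  (e0 <= #|X|)%N -> (e0 <= #|Y|)%N -> color_class G c i :&: setX X Y != set0.

(** Edges are added one at a time: at each step at least [e0] vertices on either side are neither
    forbidden nor matched, so an edge of any prescribed color is available among them. The bound is
    [n.+1] because the last edge is chosen when one fewer is in place. *)
Lemma greedy_matching G c e0 (PA PB : {set 'I_n}) m : dense_classes G c e0 ->
    (#|PA| + \sum_(i < q) m i + e0 <= n.+1)%N ->
    (#|PB| + \sum_(i < q) m i + e0 <= n.+1)%N ->
  exists M, [/\ matching M, M \subset G, [disjoint fst @: M & PA],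
    [disjoint snd @: M & PB] & forall i, #|color_class G c i :&: M| = m i].
Proof.
move=> dense; move: {2}(\sum_i m i) (erefl (\sum_i m i)) => t.
elim: t m => [|t IHt] m mt leA leB.
  exists set0; split; rewrite ?imset0 ?sub0set ?disjoints_subset ?sub0set //.
    exact: matching0.
  move=> i; rewrite setI0 cards0; move/eqP: mt; rewrite sum_nat_eq0.
  by move=> /forallP/(_ i)/implyP/(_ isT)/eqP.
have [i mi] : exists i, (0 < m i)%N.
  apply/existsP; apply: contraPT mt => /existsPn m0.
  rewrite big1 // => i _; apply/eqP; rewrite -leqn0 leqNgt; exact: m0.
have [m' m'i] : exists m', forall j, m j = (m' j + (j == i))%N.
  by exists (fun j => m j - (j == i))%N => j; case: eqP => [->|_]; rewrite ?subnK ?subn0 ?addn0.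
have sm : \sum_i m i = (\sum_i m' i).+1.
  rewrite (eq_bigr (fun j => m' j + (j == i))%N) => [|j _]; last exact: m'i.
  rewrite big_split /= -addn1; congr addn.
  by rewrite -big_mkcond /= big_pred1_eq.
have [|||M [Mm MG dA dB Mc]] := IHt m'.
- by move: sm; rewrite mt => -[].
- by move: leA; rewrite sm addnS addSn => /ltnW.
- by move: leB; rewrite sm addnS addSn => /ltnW.
have cM : #|M| = \sum_i m' i.
  by rewrite (card_color_classes c MG); apply: eq_bigr => j _; exact: Mc.
have room (P Z : {set 'I_n}) : #|Z| = #|M| -> (#|P| + \sum_i m i + e0 <= n.+1)%N ->
    (e0 <= #|~: (P :|: Z)|)%N.
  rewrite sm -cM => ZM hP; have := cardsC (P :|: Z); rewrite card_ord cardsU => hC.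
  have := subset_leq_card (subsetIl P Z); lia.
have /set0Pn[e] := dense i _ _ (room PA _ (matching_card_fst Mm) leA)
  (room PB _ (matching_card_snd Mm) leB).
rewrite !inE !negb_or => /and3P[/andP[eG /eqP ei] /andP[eA eMf] /andP[eB eMs]].
have eM : e \notin M by apply: contra eMf => ?; exact: imset_f.
exists (e |: M); split.
- by apply: matchingU => //; [exact: matching1| |]; rewrite imset_set1 disjoints1.
- by rewrite subUset sub1set eG.
- rewrite imsetU imset_set1 disjoints_subset subUset sub1set inE eA /=.
  by rewrite -disjoints_subset.
- rewrite imsetU imset_set1 disjoints_subset subUset sub1set inE eB /=.
  by rewrite -disjoints_subset.
- move=> j; rewrite m'i -Mc setIUr cardsU addnC.
  rewrite setIACA.
  have -> : [set e] :&: M = set0 by apply/setP => x; rewrite !inE; case: eqP => // ->; apply/negbTE.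
  rewrite !setI0 cards0 subn0; congr addn.
  have [ij|ij] := eqVneq j i.
    by rewrite (setIidPr _) ?cards1 // sub1set inE eG ij ei eqxx.
  apply/eqP; rewrite cards_eq0; apply/eqP/setP => x; rewrite !inE.
  by case: (x =P e) => [->|_]; rewrite ?andbF // ei eq_sym (negbTE ij) andbF.
Qed.

Lemma profile_realized G c (R : {set 'I_n}) (d : 'I_q -> nat) e0 h m :
    (0 < q)%N -> (q * (#|R| + h + e0) <= n)%N -> dense_classes G c e0 ->
    (forall k, expands (color_class G c k) R (d k) e0 h) ->
    (forall k, expands (transpose (color_class G c k)) R (d k) e0 h) ->
  (\sum_(i < q) m i = n)%N -> mcp G c m.
Proof.
move=> q0 small dense expl expr sm.
(* Pigeonhole: the [q] numbers [m k] have sum [n]. *)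
have [k mk] : exists k, (#|R| + h + e0 <= m k)%N.
  have [|no] := boolP [exists k, (#|R| + h + e0 <= m k)%N].
    by move=> /existsP.
  have lt i : (m i < #|R| + h + e0)%N.
    by rewrite ltnNge; move: no; rewrite negb_exists => /forallP.
  pose i0 := Ordinal q0.
  suff : (\sum_(i < q) m i < \sum_(i < q) (#|R| + h + e0))%N.
    by rewrite sm sum_nat_const card_ord ltnNge small.
  rewrite (bigD1 i0) // [X in (_ < X)%N](bigD1 i0) //= -addSn.
  by rewrite leq_add // leq_sum // => i _; exact: ltnW.
set Ek := color_class G c k.
(* The vertices that the greedy phase avoids on each side: the reserve [R] and the neighbors of the
   poor vertices of the opposite side. *)
pose PA := R :|: nbhd (transpose Ek) (poor (transpose Ek) R (4 * d k)).
pose PB := R :|: nbhd Ek (poor Ek R (4 * d k)).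
have cPA : (#|PA| <= #|R| + h)%N.
  have [le _ _] := expr k; apply: leq_trans (leq_add (leqnn _) le).
  by rewrite -(cardsID R) /PA setDUl setDv set0U leq_add2r subset_leq_card ?subsetIr.
have cPB : (#|PB| <= #|R| + h)%N.
  have [le _ _] := expl k; apply: leq_trans (leq_add (leqnn _) le).
  by rewrite -(cardsID R) /PB setDUl setDv set0U leq_add2r subset_leq_card ?subsetIr.
pose m0 i := if i == k then 0 else m i.
have sm0 : (\sum_(i < q) m0 i + m k)%N = n.
  rewrite -sm (bigD1 k) //= {1}/m0 eqxx add0n [RHS](bigD1 k) //= addnC; congr addn.
  by apply: eq_bigr => i /negbTE ik; rewrite /m0 ik.
have fit (P : {set 'I_n}) t : (#|P| <= #|R| + h)%N -> (t + m k = n)%N ->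
    (#|P| + t + e0 <= n.+1)%N by lia.
have [||M [Mm MG dA dB Mc]] := greedy_matching dense (PA := PA) (PB := PB) (m := m0).
- exact: fit cPA sm0.
- exact: fit cPB sm0.
have cM : (#|M| + m k)%N = n.
  rewrite -[RHS]sm0 (card_color_classes c MG); congr addn; apply: eq_bigr => j _; exact: Mc.
set A := ~: fst @: M; set B := ~: snd @: M.
have cA : #|A| = m k.
  by have := cardsC (fst @: M); rewrite card_ord matching_card_fst // -[RHS]cM => /addnI.
have cB : #|B| = m k.
  by have := cardsC (snd @: M); rewrite card_ord matching_card_snd // -[RHS]cM => /addnI.
have PAA : PA \subset A by rewrite -disjoints_subset disjoint_sym.
have PBB : PB \subset B by rewrite -disjoints_subset disjoint_sym.
(* The unmatched vertices contain [PA] and [PB], so [expands_hall] covers small sets on both sides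
   and density covers the rest. *)
have /hall_marriage [M' [Mm' ME' Mf' Ms']] : forall X : {set 'I_n}, X \subset A ->
    (#|X| <= #|nbhd Ek X :&: B|)%N.
  apply: (@hall_two_sided _ _ Ek e0); first by rewrite cA cB.
  - apply: (expands_hall (expl k)).
      exact: subset_trans (subsetUl _ _) PBB.
    exact: subset_trans (subsetUr _ _) PBB.
  - apply: (expands_hall (expr k)).
      exact: subset_trans (subsetUl _ _) PAA.
    exact: subset_trans (subsetUr _ _) PAA.
  - exact: dense.
have disM : M :&: M' = set0.
  apply/setP => e; rewrite !inE; apply/negP => /andP[eM eM'].
  have := imset_f fst eM'; rewrite Mf' /A inE => /negP; apply; exact: imset_f.
have EkG : Ek \subset G by apply/subsetP => e; rewrite inE => /andP[].
exists (M :|: M'); split.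
  apply: perfect_matching_of_card.
  - by rewrite subUset MG (subset_trans ME').
  - apply: matchingU => //.
      by rewrite Mf' disjoints_subset /A setCK.
    by rewrite disjoint_sym disjoints_subset.
  - by rewrite cardsU disM cards0 subn0 -[X in (_ + X)%N](matching_card_fst Mm') Mf' cA.
move=> i; rewrite setIUr cardsU setIACA setIid disM setI0 cards0 subn0 Mc /m0.
case: eqP => [->|/eqP ik].
  by rewrite (setIidPr ME') -cA -Mf' matching_card_fst.
suff -> : color_class G c i :&: M' = set0 by rewrite cards0 addn0.
apply/setP => e; rewrite !inE; apply/negP => /andP[/andP[_ /eqP ei]] /(subsetP ME').
by rewrite inE ei (negbTE ik) andbF.
Qed.
End Profiles.

(** * Random edge sets *)

Local Open Scope ring_scope.

Section Expectation.
Variables (K : realType) (n : nat).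
Implicit Types (p z : K) (E F : {set edge n}).

Definition expectation p (f : {set edge n} -> K) : K :=
  \sum_(E : {set edge n}) graph_weight p E * f E.

Lemma graph_weight_ge0 p E : 0 <= p <= 1 -> 0 <= graph_weight p E.
Proof.
move=> /andP[p0 p1]; apply: prodr_ge0 => e _.
by case: ifP => // _; rewrite subr_ge0.
Qed.

Lemma expectationD p f g :
  expectation p (fun E => f E + g E) = expectation p f + expectation p g.
Proof. by rewrite -big_split; apply: eq_bigr => E _; rewrite mulrDr. Qed.

Lemma expectationD3 p f g h :
  expectation p (fun E => f E + g E + h E) =
  expectation p f + expectation p g + expectation p h.
Proof. by rewrite !expectationD. Qed.

Lemma expectationM p a f :
  expectation p (fun E => a * f E) = a * expectation p f.
Proof. by rewrite mulr_sumr; apply: eq_bigr => E _; rewrite mulrCA. Qed.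

Lemma expectation_sum p (I : finType) (P : pred I) (f : I -> {set edge n} -> K) :
  expectation p (fun E => \sum_(i | P i) f i E) = \sum_(i | P i) expectation p (f i).
Proof. by rewrite exchange_big; apply: eq_bigr => E _; rewrite mulr_sumr. Qed.

Lemma expectation_transpose p f :
  expectation p (fun E => f (transpose E)) = expectation p f.
Proof.
have trK : involutive (@transpose 'I_n 'I_n).
  by move=> E; apply/setP => -[a b]; rewrite !inE.
rewrite /expectation [RHS](reindex_inj (inv_inj trK)); apply: eq_bigr => E _.
congr (_ * _); rewrite /graph_weight.
rewrite (reindex_inj (can_inj (@swap_pairK 'I_n 'I_n))) /=.
by apply: eq_bigr => e _; rewrite inE.
Qed.

Lemma expectation_prod p (f g : edge n -> K) :
  expectation p (fun E => \prod_e (if e \in E then f e else g e)) =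
  \prod_e (p * f e + (1 - p) * g e).
Proof.
rewrite bigA_distr; apply: eq_bigr => E _; rewrite -big_split.
by apply: eq_bigr => e _ /=; case: ifP.
Qed.

Lemma prod_two_sets (F1 F2 : {set edge n}) (a1 a2 : K) : [disjoint F1 & F2] ->
  \prod_e (if e \in F1 then a1 else if e \in F2 then a2 else 1) =
  a1 ^+ #|F1| * a2 ^+ #|F2|.
Proof.
move=> dis; rewrite -!prodr_const [X in _ = X * _]big_mkcond.
rewrite [X in _ = _ * X]big_mkcond -big_split; apply: eq_bigr => e _ /=.
have [eF1|_] := ifPn; last by rewrite mul1r.
by rewrite (disjointFr dis eF1) mulr1.
Qed.

(** The joint generating function of two independent binomial edge counts. Since [0 ^+ 0 = 1], base
    0 gives the probability that there is no edge. *)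
Lemma expectation_expn2 p z1 z2 (F1 F2 : {set edge n}) : [disjoint F1 & F2] ->
  expectation p (fun E => z1 ^+ #|E :&: F1| * z2 ^+ #|E :&: F2|) =
  (p * z1 + (1 - p)) ^+ #|F1| * (p * z2 + (1 - p)) ^+ #|F2|.
Proof.
move=> dis; rewrite -prod_two_sets //.
pose w e := if e \in F1 then z1 else if e \in F2 then z2 else 1.
transitivity (expectation p (fun E => \prod_e (if e \in E then w e else 1))).
  apply: eq_bigr => E _; congr (_ * _); rewrite -prod_two_sets; last first.
    by apply: disjointW dis; rewrite subsetIr.
  by apply: eq_bigr => e _; rewrite !inE /w; case: (e \in E).
rewrite expectation_prod; apply: eq_bigr => e _; rewrite /w mulr1.
by do 2 case: ifP => // _; rewrite mulr1 addrC subrK.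
Qed.

Lemma expectation_expn p z F :
  expectation p (fun E => z ^+ #|E :&: F|) = (p * z + (1 - p)) ^+ #|F|.
Proof.
have F0 : [disjoint F & set0] by rewrite disjoint_sym disjoints_subset sub0set.
rewrite -[RHS]mulr1 -[X in _ = _ * X](expr0 (p * 1 + (1 - p))).
rewrite -{1}(@cards0 (edge n)) -(expectation_expn2 p z 1 F0).
by apply: eq_bigr => E _; rewrite expr1n mulr1.
Qed.

End Expectation.

(** * The law of a color class and Markov's inequality *)

Section Marginal.
Variables (K : realType) (q n : nat) (alpha : 'I_q -> K).
Hypothesis alpha_sum : \sum_i alpha i = 1.

(** Each potential edge is present with color [k] with probability [p * alpha k], independently of
    the others, so a single color class is again a binomial random bipartite graph. *)
Lemma color_class_law p k (f : {set edge n} -> K) :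
  \sum_(w : bigraph n * coloring q n)
     graph_weight p w.1 * coloring_weight alpha w.2 * f (color_class w.1 w.2 k) =
  expectation (p * alpha k) f.
Proof.
(* The indicator that the color class is [E], written as a product over edges so that the sums over
   [G] and [c] factor edge by edge. *)
pose hit (G : bigraph n) (c : coloring q n) (E : {set edge n}) : K :=
  \prod_e (((e \in G) && (c e == k)) == (e \in E))%:R.
have hitE G c E : hit G c E = (color_class G c k == E)%:R.
  rewrite /hit; have [<-|neq] := eqVneq; last first.
    have [e] : exists e, e \in color_class G c k != (e \in E).
      by apply/existsP; apply: contraR neq => /existsPn eqE;
        apply/eqP/setP => e; apply/eqP; rewrite -[_ == _]negbK eqE.
    rewrite inE => /negbTE ne; apply/eqP/prodf_eq0; exists e => //.
    by rewrite ne.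
  by rewrite big1 // => e _; rewrite inE eqxx.
transitivity (\sum_(w : bigraph n * coloring q n) \sum_(E : {set edge n})
     graph_weight p w.1 * coloring_weight alpha w.2 * hit w.1 w.2 E * f E).
  apply: eq_bigr => w _; rewrite (bigD1 (color_class w.1 w.2 k)) //= big1.
    by rewrite addr0 hitE eqxx mulr1.
  by move=> E /negbTE; rewrite eq_sym hitE => ->; rewrite mulr0 mul0r.
rewrite exchange_big; apply: eq_bigr => E _ /=; rewrite -mulr_suml; congr (_ * _).
rewrite -(pair_bigA _ (fun G c => graph_weight p G * coloring_weight alpha c *
   hit G c E)) /= exchange_big /=.
transitivity (\sum_(c : coloring q n) \prod_e (alpha (c e) *
    (p * ((c e == k) == (e \in E))%:R + (1 - p) * (e \notin E)%:R))).
  apply: eq_bigr => c _; rewrite big_split /= -expectation_prod mulr_sumr.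
  apply: eq_bigr => G _; rewrite -mulrA mulrCA; do 2 congr (_ * _).
  apply: eq_bigr => e _.
  by case: (e \in G) => //=; case: (e \in E).
rewrite -(bigA_distr_bigA (fun e i => alpha i *
  (p * ((i == k) == (e \in E))%:R + (1 - p) * (e \notin E)%:R))).
apply: eq_bigr => e _; case: (e \in E) => /=.
  rewrite (bigD1 k) //= eqxx /= mulr0 addr0 mulr1 big1 ?addr0 1?mulrC //.
  by move=> i /negbTE -> /=; rewrite !mulr0 addr0 mulr0.
rewrite (eq_bigr (fun i => alpha i * 1 - (alpha i * (i == k)%:R) * p)).
  rewrite sumrB -mulr_suml alpha_sum -mulr_suml (bigD1 k) //= big1 ?eqxx.
    by rewrite addr0 !mulr1 mulrC.
  by move=> i /negbTE ->; rewrite mulr0.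
by move=> i _; case: (i == k) => /=; ring.
Qed.

(** Markov's inequality: the total penalty is at least 1 outside [A], and its expectation splits
    over the colors, of which only the marginal laws matter. *)
Lemma Pr_ge p (A : set (bigraph n * coloring q n)) (f : 'I_q -> {set edge n} -> K) :
    (forall i, 0 <= alpha i) -> 0 <= p <= 1 -> (0 < q)%N ->
    (forall k E, 0 <= f k E) ->
    (forall w, ~ A w -> 1 <= \sum_k f k (color_class w.1 w.2 k)) ->
  1 - \sum_k expectation (p * alpha k) (f k) <= Pr p alpha A <= 1.
Proof.
move=> alpha0 p01 q0 f0 fA.
pose W (w : bigraph n * coloring q n) := graph_weight p w.1 * coloring_weight alpha w.2.
have W0 w : 0 <= W w by rewrite mulr_ge0 ?graph_weight_ge0 // prodr_ge0.
(* The total mass comes from the law of one color class, applied to the constant function 1. *)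
have W1 : \sum_w W w = 1.
  have := color_class_law p (Ordinal q0) (fun=> 1).
  rewrite (eq_bigr W) => [->|w _]; last by rewrite mulr1.
  rewrite /expectation.
  transitivity (expectation (p * alpha (Ordinal q0))
      (fun E : {set edge n} => \prod_e (if e \in E then 1 else 1))).
    by apply: eq_bigr => E _; congr (_ * _); rewrite big1 // => e _; case: ifP.
  rewrite expectation_prod big1 // => e _; rewrite !mulr1; ring.
have split1 : Pr p alpha A + \sum_(w | w \notin A) W w = 1.
  by rewrite -W1 [RHS](bigID [in A]).
have : 0 <= \sum_(w | w \notin A) W w by apply: sumr_ge0.
suff : \sum_(w | w \notin A) W w <= \sum_k expectation (p * alpha k) (f k) by lra.
under [leRHS]eq_bigr do rewrite -color_class_law.
rewrite exchange_big /= [leRHS](bigID [in A]) /= -[leLHS]add0r lerD //.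
  by apply: sumr_ge0 => w _; apply: sumr_ge0 => k _; rewrite mulr_ge0 // W0.
apply: ler_sum => w; rewrite notin_setE => /fA h.
by rewrite -mulr_sumr -[leLHS]mulr1 ler_wpM2l // W0.
Qed.
End Marginal.

(** * Exponential-moment penalties *)

Section Penalties.
Variables (K : realType) (n : nat).
Implicit Types (E : {set edge n}) (XY : {set 'I_n} * {set 'I_n}).

Definition small_pair e0 XY : bool := (0 < #|XY.1| < e0)%N && (#|XY.2|.+1 == #|XY.1|).

(* 0 ^+ m is the indicator of m = 0; the other factors z ^+ (e - threshold),
   with e an edge count, are those of Chernoff's bound. *)
Definition dense_penalty e0 E : K :=
  \sum_(XY : {set 'I_n} * {set 'I_n} | (e0 <= #|XY.1|)%N && (e0 <= #|XY.2|)%N)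
    0 ^+ ecount E XY.1 XY.2.

(** Markov's inequality for the number of vertices outside [R] with a poor neighbor: a poor [a] has
    weight [2 ^+ d * 2^-1 ^+ ecount E [set a] R >= 1]. As [b] is outside [R], the edge [(a, b)] is
    independent of this weight. *)
Definition poor_penalty (R : {set 'I_n}) d h E : K :=
  2 ^+ d / h.+1%:R * \sum_a \sum_(b | b \notin R)
    (((a, b) \in E)%:R * 2^-1 ^+ ecount E [set a] R).

Definition sparse_penalty (z : K) d e0 E : K :=
  \sum_(XY | small_pair e0 XY) z ^- (d * #|XY.1|) * z ^+ ecount E XY.1 XY.2.

(** The factor with base 0 says that all neighbors of [U] lie in [Y]. The base [z] depends on [#|X|]
    so that it can be optimized for each size. *)
Definition tree_penalty (z : nat -> K) e0 E : K :=
  \sum_(XY | small_pair e0 XY)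
    \sum_(U : {set 'I_n} | (U \subset XY.1) && (3 * #|XY.1| <= 4 * #|U|)%N)
      z #|XY.1| ^- (2 * #|XY.2|) *
      (0 ^+ ecount E U (~: XY.2) * z #|XY.1| ^+ ecount E XY.1 XY.2).

Lemma dense_penalty_ge0 e0 E : 0 <= dense_penalty e0 E.
Proof. by apply: sumr_ge0 => XY _; rewrite exprn_ge0. Qed.

Lemma poor_penalty_ge0 R d h E : 0 <= poor_penalty R d h E.
Proof.
rewrite mulr_ge0 ?divr_ge0 ?exprn_ge0 //.
by do 2 (apply: sumr_ge0 => ? _); rewrite mulr_ge0 ?exprn_ge0 ?invr_ge0.
Qed.

Lemma sparse_penalty_ge0 z d e0 E : 1 <= z -> 0 <= sparse_penalty z d e0 E.
Proof.
move=> z1; have z0 : 0 <= z by exact: le_trans z1.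
by apply: sumr_ge0 => XY _; rewrite mulr_ge0 ?invr_ge0 ?exprn_ge0.
Qed.

Lemma tree_penalty_ge0 z e0 E : (forall s, 1 <= z s) -> 0 <= tree_penalty z e0 E.
Proof.
move=> z1; have z0 s : 0 <= z s by exact: le_trans (z1 s).
by do 2 (apply: sumr_ge0 => ? _); rewrite !mulr_ge0 ?invr_ge0 ?exprn_ge0.
Qed.

(** A pair without edges contributes [0 ^+ 0 = 1] on its own. *)
Lemma dense_of_penalty e0 E : dense_penalty e0 E < 1 -> forall X Y : {set 'I_n},
  (e0 <= #|X|)%N -> (e0 <= #|Y|)%N -> E :&: setX X Y != set0.
Proof.
move=> small X Y eX eY; apply: contraTneq small => XY0; rewrite -leNgt.
rewrite /dense_penalty (bigD1 (X, Y)) /=; last by rewrite eX.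
rewrite /ecount XY0 cards0 expr0 lerDl.
by apply: sumr_ge0 => XY _; rewrite exprn_ge0.
Qed.

Lemma poor_of_penalty R d h E : poor_penalty R d h E < 1 ->
  (#|nbhd E (poor E R d) :\: R| <= h)%N.
Proof.
apply: contraTT; rewrite -ltnNge -leNgt => big.
rewrite /poor_penalty -mulrA mulrCA ler_pdivlMl ?ltr0n // mulr1 exchange_big /=.
apply: (@le_trans _ _ (#|nbhd E (poor E R d) :\: R|)%:R); first by rewrite ler_nat.
rewrite -sum1_card natr_sum big_mkcond /= mulr_sumr [leRHS]big_mkcond /=.
apply: ler_sum => b _; rewrite in_setD.
case bR: (b \in R) => //=; case: ifP => [|_]; last first.
  by rewrite mulr_ge0 ?exprn_ge0 // sumr_ge0 // => a _; rewrite mulr_ge0 ?exprn_ge0 ?invr_ge0.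
(* One poor neighbor [a] of [b] already contributes at least 1 to the inner sum. *)
move=> /nbhdP[a]; rewrite inE => /ltnW deg ab.
rewrite (bigD1 a) //= ab mul1r mulrDr -[leLHS]addr0 lerD //; last first.
  by rewrite mulr_ge0 ?exprn_ge0 // sumr_ge0 // => ? _; rewrite mulr_ge0 ?exprn_ge0 ?invr_ge0.
rewrite exprVn ler_pdivlMr ?exprn_gt0 // mul1r.
by rewrite ler_weXn2l // ler1n.
Qed.

Lemma sparse_of_penalty z d e0 E : 1 <= z -> sparse_penalty z d e0 E < 1 ->
  forall X Y : {set 'I_n}, (0 < #|X| < e0)%N -> #|Y|.+1 = #|X| ->
    (ecount E X Y < d * #|X|)%N.
Proof.
move=> z1 small X Y X0 YX; rewrite ltnNge; apply: contraTN small => le; rewrite -leNgt.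
have z0 : 0 <= z by exact: le_trans z1.
rewrite /sparse_penalty (bigD1 (X, Y)) /=; last by rewrite /small_pair X0 /= YX.
rewrite -[leLHS]addr0 lerD //; last first.
  by apply: sumr_ge0 => XY _; rewrite mulr_ge0 ?invr_ge0 ?exprn_ge0.
rewrite ler_pdivlMl ?exprn_gt0 ?(lt_le_trans _ z1) // mulr1.
by rewrite ler_weXn2l.
Qed.

Lemma tree_of_penalty z e0 E : (forall s, 1 <= z s) -> tree_penalty z e0 E < 1 ->
  forall X Y U : {set 'I_n}, (0 < #|X| < e0)%N -> #|Y|.+1 = #|X| -> U \subset X ->
    (3 * #|X| <= 4 * #|U|)%N -> nbhd E U \subset Y -> (ecount E X Y < 2 * #|Y|)%N.
Proof.
move=> z1 small X Y U X0 YX UX U34 UY; rewrite ltnNge.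
apply: contraTN small => le; rewrite -leNgt.
have z0 s : 0 <= z s by exact: le_trans (z1 s).
rewrite /tree_penalty (bigD1 (X, Y)) /=; last by rewrite /small_pair X0 /= YX.
rewrite -[leLHS]addr0 lerD //; last first.
  by do 2 (apply: sumr_ge0 => ? _); rewrite !mulr_ge0 ?invr_ge0 ?exprn_ge0.
rewrite (bigD1 U) /=; last by rewrite UX.
rewrite -[leLHS]addr0 lerD //; last first.
  by apply: sumr_ge0 => ? _; rewrite !mulr_ge0 ?invr_ge0 ?exprn_ge0.
have -> : ecount E U (~: Y) = 0%N.
  apply/eqP; rewrite cards_eq0; apply/eqP/setP => -[a b]; rewrite !inE /=.
  apply/negP => /and3P[ab aU /negP]; apply.
  by apply: (subsetP UY); apply/nbhdP; exists a.
rewrite expr0 mul1r ler_pdivlMl ?exprn_gt0 ?(lt_le_trans _ (z1 _)) // mulr1.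
by rewrite ler_weXn2l.
Qed.

Lemma sum_small_pairs e0 (g : nat -> K) :
  \sum_(XY | small_pair e0 XY) g #|XY.1| =
  \sum_(1 <= s < e0) ('C(n, s) * 'C(n, s.-1))%:R * g s.
Proof.
rewrite big_mkcond /= big_nat_cond [RHS]big_mkcond /=.
transitivity (\sum_(XY : {set 'I_n} * {set 'I_n}) \sum_(1 <= s < e0)
   if (#|XY.1| == s) && (#|XY.2| == s.-1) then g s else 0).
  apply: eq_bigr => -[X Y] _ /=; rewrite /small_pair /=; case: ifP => [|no].
    move=> /andP[/andP[X0 Xe] /eqP YX].
    rewrite (bigD1_seq #|X|) ?mem_index_iota ?X0 ?iota_uniq //=.
    rewrite -YX /= eqxx big1 ?addr0 ?eqxx // => s /negbTE.
    by rewrite eq_sym => ->.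
  rewrite big_nat_cond big1 // => s /andP[/andP[s1 se] _].
  case: ifP => // /andP[/eqP Xs /eqP Ys]; move: no.
  by rewrite Xs Ys prednK // eqxx s1 se.
rewrite exchange_big /= big_nat_cond [RHS]big_nat_cond; apply: eq_bigr => s.
move=> /andP[-> _]; rewrite -big_mkcond /= sumr_const mulr_natl; congr (_ *+ _).
rewrite -[in RHS](card_ord n) -!card_draws -cardsX -[RHS]cardsE; apply: eq_card => -[X Y].
by rewrite !inE.
Qed.

End Penalties.

(** * Expectations of the penalties *)

Section ExpectedPenalties.
Variables (K : realType) (n : nat) (p : K).
Hypothesis p01 : 0 <= p <= 1.

Let p_ge0 : 0 <= p. Proof. by case/andP: p01. Qed.
Let q_ge0 : 0 <= 1 - p. Proof. by case/andP: p01 => _; rewrite subr_ge0. Qed.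

Lemma expr_le_expR (x : K) m : 0 <= 1 + x -> (1 + x) ^+ m <= expR (m%:R * x).
Proof.
by move=> x0; rewrite expRM_natl lerXn2r ?nnegrE ?expR_ge0 // expR_ge1Dx.
Qed.

(** Union bound over at most [4 ^+ n] pairs, each spanning no edge with probability at most
    [(1 - p) ^+ (e0 * e0)]. *)
Lemma expectation_dense_penalty e0 :
  expectation p (dense_penalty K e0 : {set edge n} -> K) <=
  4 ^+ n * expR ((e0 * e0)%:R * - p).
Proof.
rewrite /dense_penalty expectation_sum.
apply: (@le_trans _ _ (\sum_(XY : {set 'I_n} * {set 'I_n}) expR ((e0 * e0)%:R * - p))).
  rewrite big_mkcond; apply: ler_sum => -[X Y] _ /=.
  case: ifP => [/andP[eX eY]|_]; last exact: expR_ge0.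
  rewrite expectation_expn mulr0 add0r cardsX.
  apply: le_trans (expr_le_expR _ _) _ => //.
  by rewrite ler_expR !mulrN lerN2 ler_wpM2r // ler_nat leq_mul.
rewrite sumr_const card_prod -cardsT -powersetT card_powerset cardsT card_ord.
by rewrite -[leLHS]mulr_natl natrM natrX -exprMn -natrM.
Qed.

Lemma expectation_poor_penalty (R : {set 'I_n}) d h :
  expectation p (poor_penalty K R d h) <=
  2 ^+ d / h.+1%:R * (n%:R * n%:R * p * expR (#|R|%:R * - (p / 2))).
Proof.
rewrite expectationM ler_wpM2l ?divr_ge0 ?exprn_ge0 //.
have half : 1 + - (p / 2) = p * 2^-1 + (1 - p) by field.
rewrite expectation_sum.
apply: (@le_trans _ _ (\sum_(a : 'I_n) \sum_(b : 'I_n)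
    p * expR (#|R|%:R * - (p / 2)))); last first.
  by rewrite !sumr_const card_ord -mulrnA -[leLHS]mulr_natl natrM !mulrA.
apply: ler_sum => a _; rewrite expectation_sum [leLHS]big_mkcond.
apply: ler_sum => b _ /=; case: ifP => [bR|_]; last by rewrite mulr_ge0 ?expR_ge0.
have dis : [disjoint [set (a, b)] & setX [set a] R].
  by rewrite disjoints1 !inE eqxx.
(* The indicator of an edge is rewritten as 1 minus the indicator [0 ^+ #|E :&: [set (a, b)]|] of
   its absence, to which the generating function applies. *)
have -> : expectation p (fun E : {set edge n} =>
      ((a, b) \in E)%:R * 2^-1 ^+ ecount E [set a] R) =
    expectation p (fun E => 2^-1 ^+ #|E :&: setX [set a] R|) + (-1) *
    expectation p (fun E =>
      0 ^+ #|E :&: [set (a, b)]| * 2^-1 ^+ #|E :&: setX [set a] R|).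
  rewrite -expectationM -expectationD; apply: eq_bigr => E _; congr (_ * _).
  have [abE|abE] := boolP ((a, b) \in E).
    have -> : E :&: [set (a, b)] = [set (a, b)] by apply/setIidPr; rewrite sub1set.
    by rewrite cards1 expr1 mul0r mulr0 addr0 mul1r.
  have -> : E :&: [set (a, b)] = set0.
    by apply/setP => e; rewrite !inE; case: eqP => [->|]; rewrite ?andbF // (negbTE abE).
  by rewrite cards0 expr0 mul1r mul0r mulN1r subrr.
rewrite expectation_expn2 // expectation_expn cards1 expr1 mulr0 add0r.
rewrite cardsX cards1 mul1n -half.
have -> : forall x : K, x + -1 * ((1 - p) * x) = p * x by move=> x; ring.
by rewrite ler_wpM2l // expr_le_expR // half; apply: addr_ge0 => //; rewrite mulr_ge0.
Qed.

Lemma expectation_sparse_penalty (z : K) d e0 :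
  expectation p (sparse_penalty z d e0 : {set edge n} -> K) =
  \sum_(1 <= s < e0) ('C(n, s) * 'C(n, s.-1))%:R *
    (z ^- (d * s) * (p * z + (1 - p)) ^+ (s * s.-1)).
Proof.
rewrite -(sum_small_pairs n e0 (fun s => z ^- (d * s) * (p * z + (1 - p)) ^+ (s * s.-1))).
rewrite expectation_sum; apply: eq_bigr => -[X Y] /= /andP[_ /eqP XY].
by rewrite expectationM expectation_expn cardsX -XY.
Qed.

(** The pairs in [U] times [~: Y] are disjoint from those in [X] times [Y], so the two factors are
    independent. The choice of [U] costs at most [2 ^+ s], and [c s] bounds the first factor
    uniformly in [#|U|]. *)
Lemma expectation_tree_penalty (z c : nat -> K) e0 : (forall s, 1 <= z s) ->
    (forall s u, (0 < s < e0)%N -> (3 * s <= 4 * u)%N ->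
      (1 - p) ^+ (u * (n - s.-1)) <= c s) ->
  expectation p (tree_penalty z e0 : {set edge n} -> K) <=
  \sum_(1 <= s < e0) ('C(n, s) * 'C(n, s.-1))%:R *
    (2 ^+ s * (z s ^- (2 * s.-1) * (c s * (p * z s + (1 - p)) ^+ (s * s.-1)))).
Proof.
move=> z1 cP; have z0 s : 0 <= z s by exact: le_trans (z1 s).
rewrite -(sum_small_pairs n e0 (fun s =>
  2 ^+ s * (z s ^- (2 * s.-1) * (c s * (p * z s + (1 - p)) ^+ (s * s.-1))))).
rewrite expectation_sum; apply: ler_sum => -[X Y] /= /andP[X0 /eqP XY].
rewrite expectation_sum.
have c0 : 0 <= c #|X|.
  by apply: le_trans (cP _ #|X| X0 _); rewrite ?exprn_ge0 // leq_mul2r orbT.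
have w0 : 0 <= z #|X| ^- (2 * #|Y|) by rewrite invr_ge0 exprn_ge0.
have v0 : 0 <= (p * z #|X| + (1 - p)) ^+ (#|X| * #|Y|).
  by rewrite exprn_ge0 // addr_ge0 // mulr_ge0.
apply: (@le_trans _ _ (\sum_(U in powerset X) z #|X| ^- (2 * #|Y|) *
    (c #|X| * (p * z #|X| + (1 - p)) ^+ (#|X| * #|Y|)))); last first.
  by rewrite sumr_const card_powerset -[leLHS]mulr_natl natrX -XY.
rewrite big_mkcond [leRHS]big_mkcond; apply: ler_sum => U _; rewrite inE.
case: (U \subset X) => //=; case: ifP => [U34|_]; last by rewrite mulr_ge0 // mulr_ge0.
rewrite expectationM ler_wpM2l // expectation_expn2; last first.
  rewrite disjoints_subset; apply/subsetP => -[a b]; rewrite !inE /=.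
  by move=> /andP[_ /negbTE ->]; rewrite andbF.
rewrite mulr0 add0r !cardsX ler_wpM2r //.
have -> : #|~: Y| = (n - #|Y|)%N by rewrite [LHS]cardsCs setCK card_ord.
by have := cP _ #|U| X0 U34; rewrite -XY.
Qed.

End ExpectedPenalties.

(** * Numerical estimates *)

Section Estimates.
Variable K : realType.

Lemma sum_geometric_le2 (x : K) m : 0 <= x <= 2^-1 ->
  \sum_(1 <= s < m) x ^+ s.-1 <= 2.
Proof.
move=> /andP[x0 x2]; case: m => [|m]; first by rewrite big_geq.
rewrite big_add1 /= big_mkord.
(* The sharper bound makes the induction on the number of terms work. *)
apply: (@le_trans _ _ (2 - 2 * x ^+ m)); last by rewrite gerBl mulr_ge0 ?exprn_ge0.
elim: m => [|m IHm]; first by rewrite big_ord0 expr0 mulr1 subrr.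
rewrite big_ord_recr /=; have xm : 0 <= x ^+ m by rewrite exprn_ge0.
have : x ^+ m.+1 <= 2^-1 * x ^+ m by rewrite exprS ler_wpM2r.
by lra.
Qed.

Lemma expR_ge_expn (x : K) k : 0 <= x -> x ^+ k <= k`!%:R * expR x.
Proof.
move=> x0; case: k => [|k].
  by rewrite expr0 fact0 mul1r -[leLHS]expR0 ler_expR.
have := expR_ge1Dxn k x0; rewrite -ler_pdivrMl ?ltr0n ?fact_gt0 // mulrC.
by apply: le_trans; rewrite lerDr.
Qed.

Lemma expRN_le (x : K) k : 0 < x -> expR (- x) <= k`!%:R / x ^+ k.
Proof.
move=> x0; rewrite expRN ler_pdivlMr ?exprn_gt0 // mulrC ler_pdivrMr ?expR_gt0 //.
exact/expR_ge_expn/ltW.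
Qed.

Lemma expRN_le_inv (x : K) : 0 < x -> expR (- x) <= x^-1.
Proof. by move=> x0; have := expRN_le 1 x0; rewrite (_ : 1`! = 1)%N // expr1 mul1r. Qed.

Lemma bin_le_expn n k : ('C(n, k) * k`! <= n ^ k)%N.
Proof.
rewrite bin_ffact; elim: k n => [|k IHk] [|n] //.
by rewrite ffactnSr expnSr leq_mul // leq_subr.
Qed.

(** A form of the bound (e n / k)^k on binomial coefficients, with [s] independent of [k] so that it
    also serves for [k = s - 1]. *)
Lemma binM_expn_le n k s :
  'C(n, k)%:R * s%:R ^+ k <= n%:R ^+ k * expR s%:R :> K.
Proof.
apply: (@le_trans _ _ ('C(n, k)%:R * (k`!%:R * expR s%:R))).
  by rewrite ler_wpM2l ?ler0n // expR_ge_expn.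
by rewrite mulrA ler_wpM2r ?expR_ge0 // -natrM -natrX ler_nat bin_le_expn.
Qed.

(* The optimal 1 / (p s), truncated so that the tilted penalty stays at least 1
   on the bad event. *)
Definition tilt (p : K) (s : nat) : K := Num.max 1 (p * s%:R)^-1.

Variables (n : nat) (p lam : K).
Hypotheses (p01 : 0 <= p <= 1) (lamE : lam = n%:R * p).

Let p_ge0 : 0 <= p. Proof. by case/andP: p01. Qed.
Let q_ge0 : 0 <= 1 - p. Proof. by case/andP: p01 => _; rewrite subr_ge0. Qed.
Let lam_ge0 : 0 <= lam. Proof. by rewrite lamE mulr_ge0. Qed.

(** With [t = lam / N ^+ 2], the union bound is at most exp(n (2 - t)), because [N * e0 >= n] and 4
    <= e^2. As [t >= 2] and [n >= 1], this is at most exp(2 - t). *)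
Lemma dense_estimate N : (0 < n)%N -> (0 < N)%N -> 2 * N%:R ^+ 2 <= lam ->
  expectation p (dense_penalty K (n %/ N).+1 : {set edge n} -> K) <=
  expR (2 - lam / N%:R ^+ 2).
Proof.
move=> n0 N0 lamN; apply: le_trans (expectation_dense_penalty n p01 _) _.
set e0 := (n %/ N).+1.
have N0' : 0 < N%:R ^+ 2 :> K by rewrite exprn_gt0 ?ltr0n.
have eN : n%:R <= N%:R * e0%:R :> K.
  by rewrite -natrM ler_nat mulnC ltnW // ltn_ceil.
have -> : 4 ^+ n = (2 ^+ 2) ^+ n :> K by rewrite expr2 -natrM.
rewrite -exprM.
apply: (@le_trans _ _ (expR 1 ^+ (2 * n) * expR ((e0 * e0)%:R * - p))).
  rewrite ler_wpM2r ?expR_ge0 // lerXn2r ?nnegrE ?expR_ge0 //.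
  by apply: le_trans (expR_ge1Dx _).
rewrite -expRM_natl -expRD ler_expR mulr1.
have sq : n%:R ^+ 2 <= N%:R ^+ 2 * (e0 * e0)%:R :> K.
  by rewrite natrM -expr2 -exprMn lerXn2r ?nnegrE ?mulr_ge0.
set t := lam / N%:R ^+ 2.
have t2 : 2 <= t by rewrite ler_pdivlMr.
have : n%:R * t <= (e0 * e0)%:R * p.
  rewrite /t mulrA ler_pdivrMr // lamE mulrA -expr2 [leRHS]mulrAC ler_wpM2r //.
  by rewrite mulrC.
have : (n%:R - 1) * t >= (n%:R - 1) * 2.
  by rewrite ler_wpM2l // subr_ge0 ler1n.
rewrite natrM; lra.
Qed.

(** With [t = lam / (16 * Q)], the threshold costs [2 ^+ (4 * d)], at most exp(4 t + 4), whereas the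
    edges to [R] gain exp(- 8 t); what remains is exp(- 4 t) up to constants. *)
Lemma poor_estimate Q (R : {set 'I_n}) d h : (0 < Q)%N -> (n <= Q * #|R|)%N ->
    (n <= Q * h.+1)%N -> d%:R <= lam / (16 * Q)%:R + 1 ->
  expectation p (poor_penalty K R (4 * d) h) <=
  Q%:R * expR 4 * (lam * expR (- (lam / (4 * Q)%:R))).
Proof.
move=> Q0 QR Qh dle; apply: le_trans (expectation_poor_penalty p01 _ _ _) _.
have Q0' : 0 < Q%:R :> K by rewrite ltr0n.
set t := lam / (16 * Q)%:R in dle.
have lamt : lam = t * 16 * Q%:R by rewrite -mulrA -natrM divfK // pnatr_eq0; lia.
have -> : lam / (4 * Q)%:R = 4 * t by rewrite lamt natrM; field; rewrite gt_eqF.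
have le2 : 2 ^+ (4 * d) <= expR (4 * t + 4) :> K.
  apply: (@le_trans _ _ (expR 1 ^+ (4 * d))).
    by rewrite lerXn2r ?nnegrE ?expR_ge0 //; apply: le_trans (expR_ge1Dx _).
  by rewrite -expRM_natl ler_expR mulr1 natrM; lra.
have leR : expR (#|R|%:R * - (p / 2)) <= expR (- (8 * t)).
  rewrite ler_expR mulrN lerN2.
  have : t * 16 * Q%:R <= #|R|%:R * p * Q%:R.
    by rewrite -lamt lamE [leRHS]mulrC mulrA ler_wpM2r // -natrM ler_nat.
  rewrite ler_pM2r //; lra.
have leh : n%:R / h.+1%:R <= Q%:R :> K.
  by rewrite ler_pdivrMr ?ltr0n // -natrM ler_nat.
have reorder (a b e : K) : a * b * (n%:R * n%:R * p * e) = n%:R * b * (lam * (a * e)).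
  by rewrite lamE; ring.
rewrite reorder.
have -> : Q%:R * expR 4 * (lam * expR (- (4 * t))) =
    Q%:R * (lam * (expR (4 * t + 4) * expR (- (8 * t)))).
  rewrite -expRD (_ : 4 * t + 4 - 8 * t = 4 + - (4 * t)); last by ring.
  by rewrite [in RHS]expRD; ring.
apply: ler_pM => //.
  by rewrite mulr_ge0 // mulr_ge0 ?exprn_ge0 ?expR_ge0.
by rewrite ler_wpM2l // ler_pM ?exprn_ge0 ?expR_ge0.
Qed.

(** Chernoff's bound with base [N]. For [s <= n / N] there are at most exp(2 lam s) pairs, the
    threshold gains exp(- 4 lam s), and the moment costs at most exp(lam s) because [s * N <= n];
    the products form a geometric series of ratio exp(- lam). *)
Lemma sparse_estimate N d : n%:R <= expR lam -> (0 < N)%N -> expR (4 * lam) <= N%:R ^+ d ->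
    expR (- lam) <= 2^-1 ->
  expectation p (sparse_penalty (N%:R : K) d (n %/ N).+1 : {set edge n} -> K) <=
  2 * expR (- lam).
Proof.
move=> n_le N0 Nd lam2; rewrite expectation_sparse_penalty.
apply: (@le_trans _ _ (\sum_(1 <= s < (n %/ N).+1) expR (- lam) * expR (- lam) ^+ s.-1)).
  rewrite big_nat_cond [leRHS]big_nat_cond; apply: ler_sum => -[//|s] /andP[/= sN _].
  have sNn : (s.+1 * N <= n)%N.
    by apply: leq_trans (leq_trunc_div n N); rewrite leq_mul2r -ltnS sN orbT.
  have bin_le k : ('C(n, k) <= n ^ k)%N.
    by apply: (leq_trans _ (bin_le_expn n k)); rewrite leq_pmulr // fact_gt0.
  have Ns0 : 0 < N%:R ^+ d :> K by rewrite exprn_gt0 ?ltr0n.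
  rewrite -exprS -expRM_natl.
  have -> : s.+1%:R * - lam = s.+1%:R * (2 * lam) + (- (s.+1%:R * (4 * lam)) +
     s.+1%:R * lam) by ring.
  rewrite !expRD; apply: ler_pM => //.
  - apply: mulr_ge0; first by rewrite invr_ge0 exprn_ge0.
    by rewrite exprn_ge0 // addr_ge0 // mulr_ge0.
  - rewrite (_ : s.+1%:R * (2 * lam) = (2 * s.+1)%:R * lam); last by rewrite natrM; ring.
    rewrite expRM_natl [(2 * _)%N]mulnC; apply: (@le_trans _ _ (n%:R ^+ (s.+1 * 2))).
      rewrite -natrX ler_nat expnM -mulnn leq_mul //.
      by apply: leq_trans (bin_le _) _; rewrite leq_pexp2l // (leq_trans _ sNn) ?muln_gt0.
    by rewrite lerXn2r ?nnegrE ?expR_ge0.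
  - have w0 : 0 <= p * N%:R + (1 - p) by rewrite addr_ge0 // mulr_ge0.
    apply: ler_pM; rewrite ?invr_ge0 ?exprn_ge0 //.
      rewrite expRN exprM lef_pV2 ?posrE ?exprn_gt0 ?expR_gt0 ?ltr0n //.
      by rewrite expRM_natl lerXn2r ?nnegrE ?expR_ge0 // exprn_ge0.
    have -> : p * N%:R + (1 - p) = 1 + p * (N%:R - 1) by ring.
    apply: le_trans (expr_le_expR _ _) _.
      by rewrite addr_ge0 // mulr_ge0 // subr_ge0 ler1n.
    rewrite ler_expR natrM -mulrA ler_wpM2l // lamE.
    have -> : s%:R * (p * (N%:R - 1)) = s%:R * (N%:R - 1) * p by ring.
    rewrite ler_wpM2r //; apply: le_trans (_ : (s.+1 * N)%:R <= _); last by rewrite ler_nat.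
    rewrite natrM ler_pM // ?subr_ge0 ?ler1n ?ler_nat //; lra.
rewrite -mulr_sumr mulrC ler_wpM2r ?expR_ge0 //.
by apply: sum_geometric_le2; rewrite expR_ge0.
Qed.

(** Chernoff's bound for [2 * s] edges between sets of [s.+1] and [s] vertices. With base 1 / (p
    s.+1) the moment is at most (1 + 1 / s.+1)^(s.+1 s), hence at most e^s. If that base is below 1,
    the truncated one is 1, the left side is 1, and the right side is at least 1. *)
Lemma truncated_tilt s : 0 < p ->
  tilt p s.+1 ^- (2 * s) * (p * tilt p s.+1 + (1 - p)) ^+ (s.+1 * s) <=
  expR s.+1%:R * (p * s.+1%:R) ^+ (2 * s).
Proof.
move=> p0; have ps0 : 0 < p * s.+1%:R by rewrite mulr_gt0 ?ltr0n.
rewrite /tilt; have [le1|gt1] := leP (p * s.+1%:R)^-1 1.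
  rewrite mulr1 addrC subrK !expr1n invr1 mul1r.
  rewrite -[leLHS]mul1r ler_pM //; first by rewrite -expR0 ler_expR.
  by rewrite exprn_ege1 // -invf_le1.
rewrite exprVn invrK mulrC ler_wpM2r ?exprn_ge0 ?(ltW ps0) //.
apply: (@le_trans _ _ ((1 + s.+1%:R^-1) ^+ (s.+1 * s))).
  have w0 : 0 <= p / (p * s.+1%:R) + (1 - p) by rewrite addr_ge0 // divr_ge0 ?(ltW ps0).
  rewrite lerXn2r ?nnegrE //.
  rewrite invfM mulrA divff ?gt_eqF // mul1r. by rewrite addrC lerD2r gerBl.
apply: le_trans (expr_le_expR _ _) _; first by rewrite addr_ge0 ?invr_ge0.
by rewrite ler_expR natrM mulrAC divff ?pnatr_eq0 // mul1r ler_nat.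
Qed.

Lemma tree_estimate N : (9 <= N)%N -> 0 < p ->
    2 * expR 3 * lam ^+ 2 * expR (- (lam / 6)) <= 2^-1 ->
  expectation p (tree_penalty (tilt p) (n %/ N).+1 : {set edge n} -> K) <=
  4 * expR 3 * (n%:R * expR (- lam)).
Proof.
move=> N9 p0 small.
(* An isolated vertex ([s = 1]) accounts for the full factor exp(- lam), which must not be weakened;
   each further vertex of [X] need only gain exp(- lam / 6). *)
pose c s := expR (- lam) * expR (- (lam / 6)) ^+ s.-1.
apply: le_trans (expectation_tree_penalty p01 (c := c) _ _) _.
- by move=> s; rewrite le_max lexx.
- move=> [//|s] u /andP[/= _ sN] su.
  have sNn : (s.+1 * N <= n)%N.
    by apply: leq_trans (leq_trunc_div n N); rewrite leq_mul2r -ltnS sN orbT.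
  apply: le_trans (expr_le_expR _ q_ge0) _.
  rewrite /c -expRM_natl -expRD ler_expR.
  (* For one vertex, [u >= 1] suffices. For more, [u] is at least 3/4 of [s.+1] and, since
     [9 * s.+1 <= n], [n - s] is at least 8/9 of [n]. *)
  have key : (n * (6 + s) <= 6 * (u * (n - s)))%N.
    have : (9 * s.+1 <= n)%N by apply: leq_trans sNn; rewrite mulnC leq_mul2l N9 orbT.
    case: s su {sN sNn} => [|s] su s9.
      by rewrite subn0 addn0 mulnC leq_mul2l leq_pmull //; lia.
    have [m nm] : exists m, n = (s.+1 + m)%N by exists (n - s.+1)%N; lia.
    rewrite nm addKn; rewrite nm in s9.
    have := leq_mul su (leqnn m); have : (s * (8 * s + 17) <= s * m)%N.
      by rewrite leq_mul2l; lia.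
    by clear -s9; lia.
  have : n%:R * (6 + s%:R) <= 6 * (u * (n - s))%:R :> K.
    by rewrite -natrD -!natrM ler_nat.
  move=> /(ler_wpM2r p_ge0); rewrite /= lamE; lra.
apply: (@le_trans _ _ (\sum_(1 <= s < (n %/ N).+1) 2 * expR 3 * (n%:R * expR (- lam)) *
    (2 * expR 3 * lam ^+ 2 * expR (- (lam / 6))) ^+ s.-1)); last first.
  rewrite -mulr_sumr (_ : 4 * expR 3 * _ = 2 * expR 3 * (n%:R * expR (- lam)) * 2); last first.
    by move: (expR 3) (n%:R * expR (- lam)) => ? ?; ring.
  rewrite ler_wpM2l ?mulr_ge0 ?expR_ge0 // sum_geometric_le2 // small andbT.
  by rewrite !mulr_ge0 ?exprn_ge0 ?expR_ge0.
rewrite big_nat_cond [leRHS]big_nat_cond; apply: ler_sum => -[//|s] _ /=.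
(* The powers of [s.+1] from the tilt cancel the factorials in the binomial coefficients. One factor
   [n] is left over, since [X] has one vertex more than [Y]. *)
have binb : ('C(n, s.+1) * 'C(n, s))%:R * (p * s.+1%:R) ^+ (2 * s) <=
    n%:R * lam ^+ (2 * s) * expR (2 * s.+1%:R).
  have hS : 'C(n, s.+1)%:R * s.+1%:R ^+ s <= n%:R ^+ s.+1 * expR s.+1%:R :> K.
    apply: (le_trans _ (binM_expn_le n s.+1 s.+1)).
    by rewrite ler_wpM2l // -!natrX ler_nat leq_pexp2l.
  have h := binM_expn_le n s s.+1.
  have /(ler_wpM2r (exprn_ge0 (2 * s) p_ge0)) : 'C(n, s.+1)%:R * s.+1%:R ^+ s *
      ('C(n, s)%:R * s.+1%:R ^+ s) <=
      n%:R ^+ s.+1 * expR s.+1%:R * (n%:R ^+ s * expR s.+1%:R) :> K.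
    by apply: ler_pM; rewrite ?mulr_ge0 ?exprn_ge0.
  congr (_ <= _).
    by rewrite natrM exprMn [s.+1%:R ^+ (2 * s)]exprM [s.+1%:R ^+ 2]expr2 exprMn; ring.
  rewrite (_ : 2 * s.+1%:R = s.+1%:R + s.+1%:R :> K); last by ring.
  rewrite expRD lamE exprMn [n%:R ^+ (2 * s)]exprM.
  by rewrite [n%:R ^+ 2]expr2 exprMn exprS; ring.
have c0 : 0 <= c s.+1 by rewrite mulr_ge0 ?exprn_ge0 ?expR_ge0.
set w := p * tilt p s.+1 + (1 - p).
rewrite (_ : ('C(n, s.+1) * 'C(n, s))%:R *
    (2 ^+ s.+1 * (tilt p s.+1 ^- (2 * s) * (c s.+1 * w ^+ (s.+1 * s)))) =
    2 ^+ s.+1 * c s.+1 * (('C(n, s.+1) * 'C(n, s))%:R *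
      (tilt p s.+1 ^- (2 * s) * w ^+ (s.+1 * s)))); last first.
  by move: (w ^+ _) (tilt p s.+1 ^- _) (2 ^+ _) (_%:R) => ? ? ? ?; ring.
apply: (@le_trans _ _ (2 ^+ s.+1 * c s.+1 *
    (n%:R * lam ^+ (2 * s) * expR (2 * s.+1%:R) * expR s.+1%:R))).
  rewrite ler_wpM2l ?mulr_ge0 ?exprn_ge0 //.
  apply: (@le_trans _ _ (('C(n, s.+1) * 'C(n, s))%:R *
      (expR s.+1%:R * (p * s.+1%:R) ^+ (2 * s)))).
    by rewrite ler_wpM2l // truncated_tilt.
  by rewrite mulrCA mulrC ler_wpM2r ?expR_ge0.
rewrite -[X in _ * X <= _]mulrA -expRD (_ : 2 * s.+1%:R + s.+1%:R = s.+1%:R * 3); last by ring.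
rewrite expRM_natl /c /= (exprM lam) le_eqVlt; apply/orP; left; apply/eqP.
move: (expR 3) (lam ^+ 2) (expR (- (lam / 6))) (expR (- lam)) => a b d e.
by rewrite !exprMn ![_ ^+ s.+1]exprS; ring.
Qed.
End Estimates.

(** * The total penalty of a color and its expectation *)

Section Main.
Variable K : realType.

(** The same deterministic initial segment of the indices serves on both sides. *)
Definition reserve Q n : {set 'I_n} := [set i : 'I_n | (i < (n %/ Q).+1)%N].

(** Rounded up past lam / (16 Q), so that the threshold of the sparse penalty gains enough, and by
    at most 1, so that that of the poor penalty costs little. *)
Definition rich_degree Q n (p : K) : nat := (Num.truncn (n%:R * p / (16 * Q)%:R)).+1.

Definition side_penalty Q N n (p : K) (E : {set edge n}) : K :=
  poor_penalty K (reserve Q n) (4 * rich_degree Q n p) (n %/ Q) E +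
  sparse_penalty N%:R (rich_degree Q n p) (n %/ N).+1 E +
  tree_penalty (tilt p) (n %/ N).+1 E.

Definition penalty Q N n (p : K) (E : {set edge n}) : K :=
  dense_penalty K (n %/ N).+1 E + side_penalty Q N p E + side_penalty Q N p (transpose E).

Lemma side_penalty_ge0 Q N n (p : K) (E : {set edge n}) : (0 < N)%N ->
  0 <= side_penalty Q N p E.
Proof.
move=> N0; rewrite addr_ge0 ?addr_ge0 ?poor_penalty_ge0 //.
  by rewrite sparse_penalty_ge0 // ler1n.
by rewrite tree_penalty_ge0 // => s; rewrite le_max lexx.
Qed.

Lemma penalty_ge0 Q N n (p : K) (E : {set edge n}) : (0 < N)%N -> 0 <= penalty Q N p E.
Proof.
move=> N0; apply: addr_ge0; last exact: side_penalty_ge0.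
by apply: addr_ge0; [exact: dense_penalty_ge0 | exact: side_penalty_ge0].
Qed.

Lemma expands_of_side_penalty Q N n (p : K) (E : {set edge n}) : (0 < N)%N ->
  side_penalty Q N p E < 1 ->
  expands E (reserve Q n) (rich_degree Q n p) (n %/ N).+1 (n %/ Q).
Proof.
rewrite /side_penalty => N0 small.
have N1 : 1 <= N%:R :> K by rewrite ler1n.
have z1 s : 1 <= tilt p s by rewrite le_max lexx.
have := poor_penalty_ge0 K (reserve Q n) (4 * rich_degree Q n p) (n %/ Q) E.
have := sparse_penalty_ge0 (rich_degree Q n p) (n %/ N).+1 E N1.
have := tree_penalty_ge0 (n %/ N).+1 E z1.
move=> t0 s0 p0; split.
- by apply: (@poor_of_penalty K); lra.
- by apply: (sparse_of_penalty N1); lra.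
- by apply: (tree_of_penalty z1); lra.
Qed.

Lemma card_reserve Q n : (2 <= Q)%N -> (Q <= n)%N -> #|reserve Q n| = (n %/ Q).+1.
Proof.
move=> Q2 Qn; rewrite -sum1_card.
rewrite (eq_bigl (fun i : 'I_n => (i < (n %/ Q).+1)%N)) => [|i]; last by rewrite inE.
rewrite -(big_ord_widen n (fun=> 1%N)) ?sum1_card ?card_ord //.
by apply: ltn_Pdiv => //; lia.
Qed.

Lemma mcp_of_penalty q N n (p : 'I_q -> K) (G : bigraph n) (c : coloring q n) :
    (0 < q)%N -> (4 * q <= N)%N -> (8 * q <= n)%N ->
    \sum_k penalty (4 * q) N (p k) (color_class G c k) < 1 ->
  mcp G c = all_profiles q n.
Proof.
move=> q0 qN qn small; have N0 : (0 < N)%N by lia.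
have small1 k : penalty (4 * q) N (p k) (color_class G c k) < 1.
  apply: le_lt_trans small; rewrite (bigD1 k) //= lerDl sumr_ge0 // => i _.
  exact: penalty_ge0.
apply/seteqP; split=> m; first exact: mcp_sub_all_profiles.
move=> [_ sm]; apply: (@profile_realized _ _ _ _ (reserve (4 * q) n)
  (fun k => rich_degree (4 * q) n (p k)) (n %/ N).+1 (n %/ (4 * q))) => //.
(* The three sizes add up to at most 3 n / (4 q) + 2, and [8 * q <= n] gives 2 <= n / (4 q). *)
- rewrite card_reserve; [|lia|lia].
  have := leq_trunc_div n (4 * q); have := leq_div2l n _ qN.
  by rewrite muln_gt0 q0 => /(_ isT); nia.
- move=> k X Y; apply: (@dense_of_penalty K); apply: le_lt_trans (small1 k).
  by rewrite /penalty -addrA lerDl; apply: addr_ge0; exact: side_penalty_ge0.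
- move=> k; apply: expands_of_side_penalty => //; apply: le_lt_trans (small1 k).
  by rewrite /penalty -addrA addrCA lerDl; apply: addr_ge0;
    [exact: dense_penalty_ge0 | exact: side_penalty_ge0].
- move=> k; apply: expands_of_side_penalty => //; apply: le_lt_trans (small1 k).
  by rewrite /penalty lerDr; apply: addr_ge0;
    [exact: dense_penalty_ge0 | exact: side_penalty_ge0].
Qed.

(** The lower bound on [N] turns a degree of at least lam / (16 Q) into N^d >= exp(4 lam), as the
    sparse estimate requires. The constant [C] depends only on [Q] and [N]. *)
Lemma penalty_estimate Q N : (2 <= Q)%N -> (9 <= N)%N -> expR (64 * Q%:R) <= N%:R :> K ->
  exists2 C : K, 0 < C & forall n (p w : K), C <= w -> (Q <= n)%N -> 0 <= p <= 1 ->
    ln n%:R + w <= n%:R * p -> expectation p (@penalty Q N n p) <= C / w.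
Proof.
move=> Q2 N9 NQ.
have N_gt0 : (0 < N)%N by exact: leq_trans N9.
have Q_gt0 : (0 < Q)%N by exact: ltnW.
have N0 : 0 < N%:R :> K by rewrite ltr0n.
have Q0 : 0 < Q%:R :> K by rewrite ltr0n.
have e3 : 0 < expR 3 :> K := expR_gt0 _.
have e2 : 0 < expR 2 * N%:R ^+ 2 :> K by rewrite mulr_gt0 ?expR_gt0 ?exprn_gt0.
have e4 : 0 < Q%:R ^+ 3 * expR 4 :> K by rewrite mulr_gt0 ?expR_gt0 ?exprn_gt0.
have N20 : 0 < N%:R ^+ 2 :> K by rewrite exprn_gt0.
(* The first bound brings the ratio of the geometric series for the tree penalty below 1/2, the
   second serves the dense estimate, the third gives exp(- lam) <= 1/2, and the last collects the
   constants of all penalties, the one-sided ones twice. *)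
have [C [C1 C2 C3 C4]] : exists C : K, [/\ 4 * 6 ^+ 4 * expR 3 <= C, 2 * N%:R ^+ 2 <= C, 2 <= C &
    expR 2 * N%:R ^+ 2 + 2 * (32 * Q%:R ^+ 3 * expR 4 + 2 + 4 * expR 3) <= C].
  exists (4 * 6 ^+ 4 * expR 3 + 2 * N%:R ^+ 2 + 2 +
    (expR 2 * N%:R ^+ 2 + 2 * (32 * Q%:R ^+ 3 * expR 4 + 2 + 4 * expR 3))).
  by split; lra.
exists C => [|n p w Cw Qn p01]; first by lra.
have [lam lamE] : exists lam, lam = n%:R * p by exists (n%:R * p).
rewrite -lamE => lamw.
have n0 : (0 < n)%N by exact: leq_trans Qn.
have w0 : 0 < w by lra.
have ln0 : 0 <= ln n%:R :> K by rewrite ln_ge0 // ler1n.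
have wlam : w <= lam by lra.
have lam0 : 0 < lam by lra.
have Clam : C <= lam by lra.
have p0 : 0 < p by move: lam0; rewrite lamE pmulr_rgt0 // ltr0n.
have n_w : n%:R <= expR (lam - w).
  by rewrite -[leLHS](@lnK _ n%:R) ?posrE ?ltr0n // ler_expR lerBrDr.
have n_le : n%:R <= expR lam.
  by apply: le_trans n_w _; rewrite ler_expR gerBl ltW.
have inv_le : lam^-1 <= w^-1 by rewrite lef_pV2.
have [t tE] : exists t, t = lam / (16 * Q)%:R by eexists.
have t0 : 0 <= t by rewrite tE divr_ge0 // ltW.
have /andP[dle dge] := truncn_itv t0.
have degE : rich_degree Q n p = (Num.truncn t).+1 by rewrite /rich_degree -lamE -tE.
have dense : expectation p (dense_penalty K (n %/ N).+1 : {set edge n} -> K) <=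
    expR 2 * N%:R ^+ 2 / w.
  apply: le_trans (dense_estimate p01 lamE n0 _ _) _; [by [] | by lra|].
  rewrite expRD -mulrA ler_wpM2l ?expR_ge0 //.
  apply: le_trans (expRN_le_inv _) _; first by rewrite divr_gt0.
  by rewrite invf_div ler_wpM2l // ltW.
have poor (h : nat) : h = (n %/ Q)%N ->
    expectation p (poor_penalty K (reserve Q n) (4 * rich_degree Q n p) h) <=
    32 * Q%:R ^+ 3 * expR 4 / w.
  move=> ->; have nQ : (n <= Q * (n %/ Q).+1)%N by rewrite mulnC ltnW // ltn_ceil.
  have RQ : (n <= Q * #|reserve Q n|)%N by rewrite card_reserve.
  have dt : (rich_degree Q n p)%:R <= lam / (16 * Q)%:R + 1.
    by rewrite degE -tE -natr1 lerD2r.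
  apply: le_trans (poor_estimate p01 lamE Q_gt0 RQ nQ dt) _.
  apply: (@le_trans _ _ (32 * Q%:R ^+ 3 * expR 4 / lam)); last first.
    by rewrite ler_wpM2l // -mulrA mulr_ge0 // ltW.
  have x0 : 0 < lam / (4 * Q)%:R by rewrite divr_gt0 // ltr0n muln_gt0.
  have := expRN_le 2 x0; rewrite -(ler_pM2l lam0) => h1.
  apply: (@le_trans _ _ (Q%:R * expR 4 * (lam * (2`!%:R / (lam / (4 * Q)%:R) ^+ 2)))).
    by rewrite ler_wpM2l // mulr_ge0 ?expR_ge0.
  rewrite le_eqVlt; apply/orP; left; apply/eqP; rewrite natrM (_ : 2`! = 2)%N //.
  by field; rewrite !gt_eqF.
have exp_lam := expRN_le_inv lam0.
have sparse : expectation p (sparse_penalty N%:R (rich_degree Q n p) (n %/ N).+1 :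
    {set edge n} -> K) <= 2 / w.
  apply: le_trans (sparse_estimate p01 lamE n_le _ _ _) _; first by [].
  - apply: (@le_trans _ _ (expR (64 * Q%:R) ^+ rich_degree Q n p)).
      rewrite -expRM_natl ler_expR degE.
      have lamt : lam = t * (16 * Q%:R) by rewrite tE -natrM divfK // pnatr_eq0 -lt0n muln_gt0.
      rewrite {1}lamt; have := ler_wpM2r (ltW Q0) (ltW dge); lra.
    by rewrite lerXn2r ?nnegrE ?expR_ge0.
  - apply: le_trans exp_lam _; rewrite lef_pV2 ?posrE //.
    by lra.
  - by rewrite ler_wpM2l // (le_trans exp_lam).
have tree : expectation p (tree_penalty (tilt p) (n %/ N).+1 :
    {set edge n} -> K) <= 4 * expR 3 / w.
  apply: le_trans (tree_estimate p01 lamE N9 p0 _) _; last first.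
    rewrite ler_wpM2l ?mulr_ge0 ?expR_ge0 //.
    (* n exp(- lam), which bounds the expected number of isolated vertices, is at most exp(- w):
       here the excess of lam over log n is used in full. *)
    apply: (@le_trans _ _ (expR (- w))).
      by rewrite -ler_pdivlMr ?expR_gt0 // -expRN opprK -expRD addrC.
    exact: expRN_le_inv.
  have x0 : 0 < lam / 6 by rewrite divr_gt0.
  apply: (@le_trans _ _ (2 * expR 3 * lam ^+ 2 * (3`!%:R / (lam / 6) ^+ 3))).
    by rewrite ler_wpM2l ?expRN_le // mulr_ge0 ?exprn_ge0 // ltW // mulr_gt0.
  rewrite (_ : 3`! = 6)%N // (_ : _ * _ = 2 * 6 ^+ 4 * expR 3 / lam); last first.
    by field; rewrite gt_eqF.
  by rewrite ler_pdivrMr //; lra.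
have side : expectation p (@side_penalty Q N n p) <=
    (32 * Q%:R ^+ 3 * expR 4 + 2 + 4 * expR 3) / w.
  rewrite (expectationD3 p (poor_penalty K (reserve Q n) (4 * rich_degree Q n p) (n %/ Q))
    (sparse_penalty N%:R (rich_degree Q n p) (n %/ N).+1)
    (tree_penalty (tilt p) (n %/ N).+1)).
  have := lerD (lerD (poor _ erefl) sparse) tree.
  move=> h; apply: le_trans h _. by rewrite -!mulrDl.
rewrite (expectationD3 p (dense_penalty K (n %/ N).+1) (@side_penalty Q N n p)
  (fun E => side_penalty Q N p (transpose E))) expectation_transpose.
rewrite -addrA; apply: le_trans (lerD dense (lerD side side)) _.
by rewrite -!mulrDl ler_pM2r ?invr_gt0 //; lra.
Qed.
End Main.

(** * The least color probability and the passage to the limit *)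

Section AlphaMin.
Variables (K : realType) (q : nat) (alpha : 'I_q -> K).
Hypothesis alpha_gt0 : forall i, 0 < alpha i.

Lemma alpha_min_gt0 : 0 < alpha_min alpha.
Proof. by apply: lt_bigmin. Qed.

Lemma alpha_min_le i : alpha_min alpha <= alpha i.
Proof. exact: bigmin_le_cond. Qed.

End AlphaMin.

Local Open Scope classical_set_scope.
Local Open Scope ring_scope.

Theorem theorem2 (R : realType) (q : nat) (hq : (1 <= q)%N)
  (alpha : 'I_q -> R) (alpha_gt0 : forall i : 'I_q, 0 < alpha i)
  (alpha_sum : \sum_(i < q) alpha i = 1)
  (omega : nat -> R) (omega_oo : omega n @[n --> \oo] --> +oo)
  (p : nat -> R)
  (pE : forall n : nat, (0 < n)%N ->
     p n = (ln n%:R + omega n) / (alpha_min alpha * n%:R))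
  (p01 : \forall n \near \oo, 0 <= p n <= 1) :
  Pr (p n) alpha
     [set w : bigraph n * coloring q n | mcp w.1 w.2 = all_profiles q n]
    @[n --> \oo] --> (1 : R).

Proof.
(* [Q] is taken to be [4 * q], and [N] is a constant meeting every lower bound imposed by the
   estimates. *)
have [N NQ N9] : exists2 N, expR (64 * (4 * q)%:R) <= N%:R :> R & (4 * q + 9 <= N)%N.
  pose x : R := expR (64 * (4 * q)%:R); exists ((Num.truncn x).+1 + (4 * q + 9))%N.
    have /andP[_ /ltW le] := truncn_itv (expR_ge0 (64 * (4 * q)%:R) : 0 <= x).
    by apply: le_trans le _; rewrite ler_nat leq_addr.
  by rewrite leq_addl.
have qN : (4 * q <= N)%N by apply: leq_trans N9; rewrite leq_addr.
have {}N9 : (9 <= N)%N by apply: leq_trans N9; rewrite leq_addl.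
have q2 : (2 <= 4 * q)%N by apply: (@leq_trans (4 * 1)); rewrite ?leq_mul2l.
have [C C0 CP] := penalty_estimate q2 N9 NQ.
have amin0 := alpha_min_gt0 alpha_gt0.
have alpha1 k : alpha k <= 1.
  rewrite -alpha_sum (bigD1 k) //= lerDl sumr_ge0 // => i _; exact: ltW.
apply/cvgrPdist_le => eps eps0; near=> n.
have wC : C <= omega n by near: n; exact: (cvgryPge omega).1.
(* This makes the failure bound [q * C / omega n] at most [eps]. *)
have weps : q%:R * C / eps <= omega n by near: n; exact: (cvgryPge omega).1.
have p01n : 0 <= p n <= 1 by near: n.
have n8 : (8 * q <= n)%N by near: n; exact: nbhs_infty_ge.
have n0 : (0 < n)%N by apply: leq_trans n8; rewrite muln_gt0.
have w0 : 0 < omega n by apply: lt_le_trans wC.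
have [p0 p1] := andP p01n.
have pk01 k : 0 <= p n * alpha k <= 1.
  by rewrite mulr_ge0 ?(ltW (alpha_gt0 k)) //= mulr_ile1 // ltW.
(* Since [alpha_min alpha <= alpha k], every color class, even the sparsest, has mean degree at
   least log n + omega. *)
have lamk k : ln n%:R + omega n <= n%:R * (p n * alpha k).
  have n0' : 0 < n%:R :> R by rewrite ltr0n.
  have -> : ln n%:R + omega n = n%:R * (p n * alpha_min alpha).
    by rewrite pE //; field; rewrite !gt_eqF.
  by rewrite ler_wpM2l // ler_wpM2l // alpha_min_le.
have := @Pr_ge R q n alpha alpha_sum (p n)
  [set w : bigraph n * coloring q n | mcp w.1 w.2 = all_profiles q n]
  (fun k => @penalty R (4 * q) N n (p n * alpha k)) (fun k => ltW (alpha_gt0 k)) p01n hq.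
case/(_ _ _)/andP.
- by move=> k E; apply: penalty_ge0; exact: leq_trans N9.
- move=> [G c] /= bad; rewrite leNgt; apply/negP => small; apply: bad.
  exact: mcp_of_penalty small.
move=> lower upper; rewrite ger0_norm ?subr_ge0 //.
apply: (@le_trans _ _ (\sum_(k < q) expectation (p n * alpha k)
   (@penalty R (4 * q) N n (p n * alpha k)))); first by lra.
apply: (@le_trans _ _ (\sum_(k < q) C / omega n)).
  apply: ler_sum => k _; apply: CP => //.
  by apply: leq_trans n8; rewrite leq_mul2r orbT.
by rewrite sumr_const card_ord -mulr_natl mulrA ler_pdivrMr // [leRHS]mulrC -ler_pdivrMr.
Unshelve. all: by end_near.
Qed.
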